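(* Let $X$ and $Y$ be infinite-dimensional Banach spaces such that $Y$ is sufficiently euclidean, and let $\omega$ be a non-trivial modulus. Then there are a bounded closed set $A\subset X$ and a Lipschitz mapping $f\colon A\to Y$ that satisfies condition $(W_{1,1})$ but that cannot be extended to a mapping that is $C^{1,\omega}$-smooth on a neighbourhood of $0$, i.e. there are no open neighbourhood $U\subset X$ of $0$ and no $g\in C^{1,\omega}(U;Y)$ with $g=f$ on $A\cap U$.
   Context: All normed linear spaces are real; derivatives are Fréchet derivatives; $\mathcal{L}(X;Y)$ is the space of bounded linear operators with the operator norm. A modulus is a non-decreasing function $\omega\colon[0,+\infty)\to[0,+\infty]$ continuous at $0$ with $\omega(0)=0$; it is non-trivial if $\omega(t)>0$ for every $t>0$. A mapping $h$ is uniformly continuous with modulus $\omega$ if $\|h(x)-h(y)\|\le\omega(\|x-y\|)$ for all $x,y$ in its domain. For $U\subset X$ open, $C^{1,\omega}(U;Y)$ is the space of $C^1$-smooth mappings $g\colon U\to Y$ such that $Dg$ is uniformly continuous on $U$ with modulus $K\omega$ for some $K>0$. Condition $(W_{1,1})$ for $f\colon A\to Y$, $A\subset X$: there exist $f_1\colon A\to\mathcal{L}(X;Y)$ and $M\ge0$ such that for all $x,y\in A$, $\|f(y)-f(x)-f_1(x)[y-x]\|\le M\|y-x\|^2$ and $\|f_1(y)-f_1(x)\|\le M\|y-x\|$. A Banach space $Y$ is sufficiently euclidean if there are a constant $C>0$ and a sequence of $n$-dimensional subspaces $Y_n\subset Y$, $n\in\mathbb{N}$, such that there are (linear) isomorphisms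 $T_n\colon\ell_2^n\to Y_n$ and (bounded linear) projections $P_n\colon Y\to Y_n$ onto $Y_n$ such that, setting $R_n=T_n^{-1}\circ P_n$, one has $\|R_n\|\cdot\|T_n\|\le C$ for every $n\in\mathbb{N}$. *)

(* Defs.v *)
From HB Require Import structures.
From mathcomp Require Import all_boot all_order all_algebra.
From mathcomp Require Import all_classical all_reals all_analysis.

Set Implicit Arguments.
Unset Strict Implicit.
Unset Printing Implicit Defensive.

Import Order.TTheory GRing.Theory Num.Theory.
Import numFieldNormedType.Exports.

Local Open Scope classical_set_scope.
Local Open Scope ring_scope.

Definition has_dim (R : realType) (V : lmodType R) (n : nat) (S : set V) : Prop :=
  exists b : 'I_n -> V,
    S = [set \sum_(i < n) c i *: b i | c in [set: 'I_n -> R]] /\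
    (forall c : 'I_n -> R, \sum_(i < n) c i *: b i = 0 -> forall i, c i = 0).

Definition infinite_dimensional (R : realType) (V : lmodType R) : Prop :=
  ~ exists n, has_dim n [set: V].

(* The norms are explicit arguments because the canonical norm on ['rV[R]_n] is
   the sup norm, whereas the Euclidean one is needed below.  The value is [+oo]
   for an unbounded operator. *)
Definition opnorm_wrt (R : realType) (V W : Type) (nV : V -> R) (nW : W -> R)
    (T : V -> W) : \bar R :=
  ereal_sup [set (nW (T v))%:E | v in [set v | nV v <= 1]].

Definition opnorm (R : realType) (V W : normedModType R) (T : V -> W) : \bar R :=
  opnorm_wrt (@Num.norm R V) (@Num.norm R W) T.

Definition l2norm (R : realType) (n : nat) (u : 'rV[R]_n) : R :=
  Num.sqrt (\sum_(i < n) u ord0 i ^+ 2).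

(* [T n] is an isomorphism of l_2^n onto [Yn n], [P n] a bounded projection of
   [Y] onto [Yn n], and [Rn n] is (T n)^-1 o P n, which the equation
   T n (Rn n y) = P n y determines since [T n] is injective. *)
Definition sufficiently_euclidean (R : realType) (Y : normedModType R) : Prop :=
  exists (C : R) (Yn : nat -> set Y) (T : forall n, {linear 'rV[R]_n -> Y})
         (P : nat -> {linear Y -> Y}) (Rn : forall n, Y -> 'rV[R]_n),
    0 < C /\
    forall n,
      [/\ has_dim n (Yn n),
          set_bij [set: 'rV[R]_n] (Yn n) (T n),
          continuous (P n) /\ range (P n) = Yn n /\
            (forall y, Yn n y -> P n y = y),
          (forall y, T n (Rn n y) = P n y) &
          (opnorm_wrt (@Num.norm R Y) (@l2norm R n) (Rn n) *
           opnorm_wrt (@l2norm R n) (@Num.norm R Y) (T n) <= C%:E)%E].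

(* A modulus is a function on [0, +oo[; its values at negative reals are
   irrelevant. *)
Definition modulus (R : realType) (omega : R -> \bar R) : Prop :=
  [/\ (forall t, 0 <= t -> (0 <= omega t)%E),
      (forall s t, 0 <= s -> s <= t -> (omega s <= omega t)%E),
      omega t @[t --> within [set t : R | 0 <= t] (nbhs (0 : R))] --> omega 0 &
      omega 0 = 0%E].

Definition nontrivial_modulus (R : realType) (omega : R -> \bar R) : Prop :=
  modulus omega /\ forall t, 0 < t -> (0 < omega t)%E.

(* Maps defined on a subset are total functions constrained on that subset. *)
Definition C1_modulus (R : realType) (X Y : normedModType R)
    (omega : R -> \bar R) (U : set X) (g : X -> Y) : Prop :=
  [/\ (forall x, U x -> differentiable g x),
      (forall x, U x -> opnorm ('d g y \- 'd g x) @[y --> x] --> 0%E) &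
      exists2 K : R, 0 < K & forall x y, U x -> U y ->
        (opnorm ('d g x \- 'd g y)%R <= K%:E * omega `|x - y|%R)%E].

Definition W11 (R : realType) (X Y : normedModType R)
    (A : set X) (f : X -> Y) : Prop :=
  exists (f1 : X -> {linear X -> Y}) (M : R),
    [/\ 0 <= M,
        (forall x, A x -> continuous (f1 x)) &
        forall x y, A x -> A y ->
          `|f y - f x - f1 x (y - x)| <= M * `|y - x| ^+ 2 /\
          (opnorm (f1 y \- f1 x)%R <= (M * `|y - x|)%:E)%E].

(* Main.v *)
Require Import Defs.
From HB Require Import structures.
From mathcomp Require Import all_boot all_order all_algebra.
From mathcomp Require Import all_classical all_reals all_analysis.
From mathcomp Require Import perm ring lra.

Import Order.TTheory GRing.Theory Num.Theory.
Import numFieldNormedType.Exports.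

Local Open Scope classical_set_scope.
Local Open Scope ring_scope.

Set Implicit Arguments.
Unset Strict Implicit.
Unset Printing Implicit Defensive.

(** [Phi] is only Lipschitz, so as the values of [f] it would violate the quadratic remainder bound;
    a derivative in the sense of (W_{1,1}) has only to be Lipschitz. Hence [f1] is the rank-one
    operator v |-> tau v Phi(x), with [tau] a norm-one functional such that tau e0 = 1 and tau y_k =
    0: between points of S, where f = 0, the remainder vanishes. On the upper level it is t times an
    increment of [Phi], of order t |d| for a displacement d, which is O(|d|^2) only when |d| is at
    least of order t; this is why the net is separated. The (W_{1,1}) constant must be the same for
    all pieces while an extension may have any K, so t is small depending on K. An extension
    controls second differences of g, those of g / t being 1 / t times larger, and this forces N to
    come after t. In X, random signs suffice because only grid points and their differences occur:
    finitely many coefficient vectors instead of a whole sphere. *)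

(** The obstruction is Tsarkov's: on vectors s (e_1, .., e_N) with entries e_k
in {-1, 0, 1}, a map with uniformly continuous derivative cannot stay close
to (s |e_k|)_k in l_2^N when N is large, because its second difference along each
coordinate is o(s) while that of s |e_k| is 2 s, and the N defects add up in
l_2.  It is transported into X by vectors y_1, .., y_N with |y_k| <= 6,
|sum d_k y_k| <= 12 sqrt N for d_k in {-1, 0, 1} and |d|_2 <= |sum d_k y_k| for
integers |d_k| <= 2, a weak form of Dvoretzky's theorem obtained from random
signs, and into Y by the factorization of the identity of l_2^N through Y.

Let Phi be the resulting nonsmooth 1-Lipschitz map on the finite set
S = {s sum e_k y_k}, fix e0 outside the span, and prescribe f = 0 on S and
f = t Phi on a t-separated t-net of S translated by t e0.  The separation gives
(W_{1,1}) with an absolute constant.  An extension g has e0-derivative close to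
Phi on the net, hence on S by uniform continuity, hence g / t is close to Phi on all
of S + t e0, which is excluded by choosing N large after t.  Copies of this
configuration with constants K = 1, 2, .. are placed at points tending to 0. *)

(** * The Hahn-Banach theorem *)

Section HahnBanach.
Variables (R : realType) (X : normedModType R).

Definition sublinear (p : X -> R) : Prop :=
  (forall x y, p (x + y) <= p x + p y) /\
  (forall (a : R) x, 0 <= a -> p (a *: x) = a * p x).

(** For [a > 0] the reverse inequality is the assumed one for [a^-1] at [a *: x]; at [a = 0]
    subadditivity gives [0 <= p 0]. *)
Lemma sublinear_of_le (p : X -> R) :
  (forall x y, p (x + y) <= p x + p y) ->
  (forall (a : R) x, 0 <= a -> p (a *: x) <= a * p x) -> sublinear p.
Proof.
move=> pD pZ; split=> // a x; rewrite le_eqVlt => /predU1P[<-|a0].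
  rewrite scale0r mul0r; apply/eqP; rewrite eq_le.
  have := pZ 0 0 (lexx _); rewrite scale0r mul0r => ->/=.
  by have := pD 0 0; rewrite addr0; lra.
apply/eqP; rewrite eq_le pZ ?(ltW a0) //=.
have := pZ a^-1 (a *: x); rewrite invr_ge0 (ltW a0) => /(_ isT).
rewrite scalerA mulVf ?gt_eqF// scale1r => h.
by rewrite mulrC -ler_pdivlMr // mulrC.
Qed.

Lemma sublinear0 (p : X -> R) : sublinear p -> p 0 = 0.
Proof. by case=> _ /(_ 0 0 (lexx _)); rewrite scale0r mul0r. Qed.

(* A minimal sublinear functional p equals [descend p z] for every z; at t = 1 this
   reads p x <= p (x + z) - p z, which makes p additive. *)
Definition descend (p : X -> R) (z x : X) : R :=
  inf [set p (x + t *: z) - t * p z | t in [set t : R | 0 <= t]].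

Lemma descend_le (p : X -> R) z x t : sublinear p -> 0 <= t ->
  descend p z x <= p (x + t *: z) - t * p z.
Proof.
move=> [pD pZ] t0; apply: ge_inf; last by exists t.
exists (- p (- x)) => _ [s /= s0 <-].
rewrite -(pZ s z s0).
have := pD (x + s *: z) (- x); rewrite addrAC subrr add0r; lra.
Qed.

Lemma le_descend (p : X -> R) z x y :
  (forall t : R, 0 <= t -> y <= p (x + t *: z) - t * p z) -> y <= descend p z x.
Proof.
move=> h; apply: lb_le_inf; first by exists (p (x + 0 *: z) - 0 * p z); exists 0 => /=.
by move=> _ [t /= t0 <-]; apply: h.
Qed.

Lemma descend_sublinear (p : X -> R) z : sublinear p -> sublinear (descend p z).
Proof.
move=> ps; have [pD pZ] := ps; apply: sublinear_of_le.
  move=> x y; rewrite -lerBlDr; apply: le_descend => t t0.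
  rewrite lerBlDr -lerBlDl; apply: le_descend => s s0.
  have := @descend_le p z (x + y) (t + s) ps (addr_ge0 t0 s0).
  have := pD (x + t *: z) (y + s *: z).
  rewrite addrACA -scalerDl; lra.
move=> a x; rewrite le_eqVlt => /predU1P[<-|a0].
  rewrite scale0r mul0r.
  apply: (le_trans (descend_le z 0 ps (lexx 0))).
  by rewrite scale0r addr0 mul0r subr0 sublinear0.
rewrite mulrC -ler_pdivrMr //; apply: le_descend => t t0.
rewrite ler_pdivrMr //.
have at0 : 0 <= a * t by rewrite mulr_ge0 // ltW.
apply: (le_trans (descend_le z (a *: x) ps at0)).
by rewrite -scalerA -scalerDr pZ ?(ltW a0) // -mulrA -mulrBr mulrC.
Qed.

Lemma descend_le_self (p : X -> R) z x : sublinear p -> descend p z x <= p x.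
Proof.
by move=> ps; have := descend_le z x ps (lexx 0); rewrite scale0r addr0 mul0r subr0.
Qed.

Lemma descendN (p : X -> R) z : sublinear p -> descend p z (- z) <= - p z.
Proof.
move=> ps; have := descend_le z (- z) ps ler01.
by rewrite scale1r addNr sublinear0 // mul1r sub0r.
Qed.

(** Zorn's lemma for the reversed pointwise order. A chain is bounded by its pointwise infimum,
    which is finite because s x >= - s (- x) >= - q (- x), and subadditive because, of two members
    of the chain, the smaller serves both arguments. *)
Lemma minimal_sublinear (q : X -> R) : sublinear q ->
  exists2 p, sublinear p & (forall x, p x <= q x) /\
    forall p', sublinear p' -> (forall x, p' x <= p x) -> p' = p.
Proof.
move=> qs.
pose T := {p : X -> R | sublinear p /\ forall x, p x <= q x}.
pose leT (s t : T) := `[< forall x, proj1_sig t x <= proj1_sig s x >].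
have [||||[p [ps pq]] pmin] := @Zorn T leT.
- by move=> t; apply/asboolP.
- by move=> r s t /asboolP rs /asboolP st; apply/asboolP => x; apply: le_trans (st x) (rs x).
- move=> [s s'] [t t'] /asboolP /= st /asboolP /= ts.
  apply: eq_exist; apply/funext => x; apply/eqP; by rewrite eq_le st ts.
- move=> A Atot.
  have [[a0 Aa0]|A0] := pselect (exists a, A a); last first.
    exists (exist _ q (conj qs (fun x => lexx _))) => s As.
    by exfalso; apply: A0; exists s.
  pose m (x : X) := inf [set proj1_sig s x | s in A].
  have lbm x : has_lbound [set proj1_sig s x | s in A].
    exists (- q (- x)) => _ [[s [[sD sZ] sq]] As <-] /=.
    have := sD x (- x); rewrite subrr (sublinear0 (conj sD sZ)).
    by have := sq (- x); lra.
  have m_le s x : A s -> m x <= proj1_sig s x.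
    by move=> As; apply: ge_inf => //; exists s.
  have le_m x y : (forall s, A s -> y <= proj1_sig s x) -> y <= m x.
    move=> h; apply: lb_le_inf; first by exists (proj1_sig a0 x); exists a0.
    by move=> _ [s As <-]; apply: h.
  have ms : sublinear m.
    apply: sublinear_of_le.
      move=> x y; rewrite -lerBlDr; apply: (le_m) => s As.
      rewrite lerBlDr -lerBlDl; apply: (le_m) => t At; rewrite lerBlDl.
      have [/asboolP st|/asboolP ts] := Atot s t As At.
        apply: (le_trans (m_le t _ At)).
        apply: (le_trans ((proj2_sig t).1.1 x y)).
        by rewrite lerD2r.
      apply: (le_trans (m_le s _ As)).
      apply: (le_trans ((proj2_sig s).1.1 x y)).
      by rewrite lerD2l.
    move=> a x; rewrite le_eqVlt => /predU1P[<-|a_gt0].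
      rewrite scale0r mul0r; apply: le_trans (m_le _ _ Aa0) _.
      by rewrite (sublinear0 (proj2_sig a0).1).
    rewrite mulrC -ler_pdivrMr //; apply: (le_m) => s As; rewrite ler_pdivrMr //.
    apply: le_trans (m_le _ _ As) _.
    by rewrite (proj2_sig s).1.2 ?(ltW a_gt0) // mulrC.
  have mq x : m x <= q x by apply: le_trans (m_le _ _ Aa0) ((proj2_sig a0).2 x).
  exists (exist _ m (conj ms mq)) => s As; apply/asboolP => x /=.
  exact: m_le.
exists p => //; split=> // p' p's p'p.
have p'q x : p' x <= q x by apply: le_trans (pq x).
have := pmin (exist _ p' (conj p's p'q)).
have -> : leT (exist _ p (conj ps pq)) (exist _ p' (conj p's p'q)).
  by apply/asboolP => x /=.
by move=> /(_ isT) /(f_equal (@proj1_sig _ _)).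
Qed.

(** Minimizing below [descend] of the norm at [z] forces p (- z) <= - |z|, hence equality at [z]
    once [p] is linear. Minimality gives [descend p y = p] for every [y], hence additivity. *)
Lemma norming_functional (z : X) :
  exists2 xi : {scalar X}, xi z = `|z| & forall x, `|xi x| <= `|x|.
Proof.
have ns : sublinear (fun x : X => `|x|).
  split=> [x y|a x a0]; first exact: ler_normD.
  by rewrite normrZ ger0_norm.
have [p ps [pn pmin]] := minimal_sublinear (descend_sublinear z ns).
have pD x y : p (x + y) = p x + p y.
  apply/eqP; rewrite eq_le ps.1 /=.
  have dp : descend p y = p.
    by apply: pmin; [exact: descend_sublinear | move=> u; exact: descend_le_self].
  have := descend_le y x ps ler01; rewrite dp scale1r mul1r; lra.
have pN x : p (- x) = - p x.
  by have := pD x (- x); rewrite subrr sublinear0 //; lra.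
have plin a x y : p (a *: x + y) = a * p x + p y.
  rewrite pD; congr (_ + _).
  have [a0|a0] := leP 0 a; first exact: ps.2.
  have := ps.2 (- a) x; rewrite oppr_ge0 ltW // => /(_ isT).
  rewrite scaleNr pN; lra.
have pl : linear_for *%R p by move=> a x y; exact: plin.
pose pL := GRing.isLinear.Build R X R *%R p pl.
pose xi : {scalar X} := HB.pack p pL.
have le x : p x <= `|x| by apply: le_trans (pn x) (descend_le_self z x ns).
exists xi => /=.
  apply/eqP; rewrite eq_le le /=.
  have := pn (- z); rewrite pN => h.
  have := descendN z ns; lra.
move=> x; rewrite ler_norml le andbT.
by have := le (- x); rewrite pN normrN; lra.
Qed.

End HahnBanach.

(** * Bounded biorthogonal systems *)

Section Biorthogonal.
Variables (R : realType) (X : normedModType R).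

Lemma scalar_of (p : X -> R) : (forall (a : R) x y, p (a *: x + y) = a * p x + p y) ->
  exists f : {scalar X}, f =1 p.
Proof.
move=> pl; have pl' : linear_for *%R p by move=> a x y; exact: pl.
pose pL := GRing.isLinear.Build R X R *%R p pl'.
by exists (HB.pack p pL : {scalar X}).
Qed.

Definition biorthogonal (n : nat) (x : nat -> X) (xi : nat -> {scalar X}) : Prop :=
  (forall i j, (i < n)%N -> (j < n)%N -> xi i (x j) = (i == j)%:R) /\
  exists C : R, forall i z, (i < n)%N -> `|xi i z| <= C * `|z|.

(** Otherwise every [z] would be the sum of the [xi i z *: x i], and the [x i] would form a finite
    basis. *)
Lemma biorthogonal_kernel n x xi : infinite_dimensional X -> biorthogonal n x xi ->
  exists2 z, z != 0 & forall i, (i < n)%N -> xi i z = 0.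
Proof.
move=> infX [bi _]; apply: contrapT => nz; apply: infX.
exists n, (fun i : 'I_n => x i).
have xi_sum (i : 'I_n) (c : 'I_n -> R) : xi i (\sum_(j < n) c j *: x j) = c i.
  rewrite linear_sum (bigD1 i) //= linearZ /= bi // eqxx mulr1 big1 ?addr0 //.
  move=> j ji; have /negbTE ij : (i : nat) != j by rewrite eq_sym.
  by rewrite linearZ /= bi // ij mulr0.
split.
  apply/seteqP; split=> // z _; exists (fun i : 'I_n => xi i z) => //.
  apply/eqP; rewrite eq_sym -subr_eq0; apply: contrapT => /negP zn; apply: nz.
  eexists; first exact: zn.
  move=> i ni; have := xi_sum (Ordinal ni) (fun i => xi i z) => /= e.
  by rewrite linearB /= e subrr.
by move=> c c0 i; rewrite -(xi_sum i c) c0 linear0.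
Qed.

(** The norming functional of a common zero [z] is corrected by the multiples [f (x i)] of the
    [xi i]: it then kills the [x i] and keeps its value at [z]. *)
Lemma biorthogonal_extend n x xi : infinite_dimensional X -> biorthogonal n x xi ->
  exists z zeta, biorthogonal n.+1 (fun i => if i == n then z else x i)
                                   (fun i => if i == n then zeta else xi i).
Proof.
move=> infX bio; have [z z0 xz] := biorthogonal_kernel infX bio.
case: bio => bi [C xiC].
have [f fz fle] := norming_functional z.
have [zeta zetaE] : exists g : {scalar X},
    g =1 fun y => `|z|^-1 * (f y - \sum_(i < n) f (x i) * xi i y).
  apply: scalar_of => a u v; rewrite linearP /= mulrCA -mulrDr; congr (_ * _).
  rewrite mulrBr addrACA -opprD; congr (_ - _).
  rewrite mulr_sumr -big_split /=; apply: eq_bigr => i _; rewrite linearP /= mulrDr.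
  by rewrite mulrCA.
exists z, zeta; split.
  move=> i j; rewrite !ltnS => lin ljn.
  have lt k : (k <= n)%N -> k != n -> (k < n)%N by move=> kn nk; rewrite ltn_neqAle nk.
  case: (eqVneq i n) => [->|ni].
    case: (eqVneq j n) => [_|nj].
      rewrite zetaE fz big1 ?subr0 ?mulVf ?normr_eq0 // => k _.
      by rewrite xz // mulr0.
    rewrite zetaE (bigD1 (Ordinal (lt j ljn nj))) //= bi ?lt // eqxx mulr1 big1 ?addr0 ?subrr ?mulr0 //.
    move=> k kj; have /negbTE kj' : (k : nat) != j by [].
    by rewrite bi ?kj' ?mulr0 //; apply: (lt).
  case: (eqVneq j n) => [->|nj]; first by rewrite xz ?lt // (negbTE ni).
  by rewrite bi // lt.
exists (Num.max C (`|z|^-1 * (1 + \sum_(i < n) `|f (x i)| * C))) => i y; rewrite ltnS => lin.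
case: (eqVneq i n) => [_|ni]; last first.
  apply: le_trans (xiC _ _ _) _; first by rewrite ltn_neqAle ni.
  by rewrite ler_wpM2r // le_max lexx.
apply: (@le_trans _ _ ((`|z|^-1 * (1 + \sum_(i < n) `|f (x i)| * C)) * `|y|)); last first.
  by rewrite ler_wpM2r // le_max lexx orbT.
rewrite zetaE normrM ger0_norm ?invr_ge0 // -mulrA ler_wpM2l ?invr_ge0 //.
rewrite mulrDl mul1r; apply: le_trans (ler_normB _ _) _; apply: lerD => //.
rewrite mulr_suml; apply: le_trans (ler_norm_sum _ _ _) _.
by apply: ler_sum => k _; rewrite normrM -mulrA ler_wpM2l // xiC.
Qed.

(** [e] and [tau] are chosen before [n], so that all pieces share one vertical direction and one
    functional measuring heights. They occupy index 0 of each system; dropping them leaves vectors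
    in the kernel of [tau]. *)
Lemma biorthogonal_system : infinite_dimensional X ->
  exists (e : X) (tau : {scalar X}), [/\ `|e| = 1, tau e = 1, forall x, `|tau x| <= `|x| &
    forall n, exists (x : 'I_n -> X) (xi : 'I_n -> {scalar X}) (C : R),
      [/\ forall i j, xi i (x j) = (i == j)%:R, forall i, tau (x i) = 0 &
          forall i z, `|xi i z| <= C * `|z|]].
Proof.
move=> infX.
have [z z0 _] : exists2 z : X, z != 0 & forall i, (i < 0)%N -> (0 : X) = 0.
  have [|z z0 _] := @biorthogonal_kernel 0 (fun=> 0) (fun=> sval (cid2 (norming_functional 0))) infX.
    by split=> //; exists 0.
  by exists z.
pose e := `|z|^-1 *: z.
have e1 : `|e| = 1 by rewrite normrZ ger0_norm ?invr_ge0 // mulVf ?normr_eq0.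
have [tau taue taule] := norming_functional e.
exists e, tau; split=> //; first by rewrite taue.
have H n : exists x xi, [/\ biorthogonal n.+1 x xi, x 0%N = e & xi 0%N = tau].
  elim: n => [|n [x [xi [bio x0 xi0]]]].
    exists (fun=> e), (fun=> tau); split=> //; split.
      by move=> [|i] [|j] // _ _; rewrite taue e1.
    by exists 1 => i y _; rewrite mul1r.
  have [y [zeta bio']] := biorthogonal_extend infX bio.
  by eexists; eexists; split; first exact: bio'.
move=> n; have [x [xi [[bi [C xiC]] x0 xi0]]] := H n.
exists (fun i : 'I_n => x i.+1), (fun i : 'I_n => xi i.+1), C; split.
- by move=> i j; rewrite bi ?ltnS.
- by move=> i; rewrite -xi0 bi ?ltnS.
- by move=> i y; apply: xiC; rewrite ltnS.
Qed.

End Biorthogonal.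

(** * The Dvoretzky-Rogers lemma *)

Section Sumsq.
Variable R : realType.

Definition sumsq (n : nat) (a : 'rV[R]_n) : R := (a *m a^T) 0 0.

Lemma sumsqE n (a : 'rV[R]_n) : sumsq a = \sum_j a 0 j ^+ 2.
Proof. by rewrite /sumsq mxE; apply: eq_bigr => j _; rewrite mxE expr2. Qed.

Lemma sumsq_ge0 n (a : 'rV[R]_n) : 0 <= sumsq a.
Proof. by rewrite sumsqE sumr_ge0 // => j _; rewrite sqr_ge0. Qed.

Lemma sumsq_eq0 n (a : 'rV[R]_n) : sumsq a = 0 -> a = 0.
Proof.
rewrite sumsqE => /eqP; rewrite psumr_eq0 => [|j _]; last by rewrite sqr_ge0.
move=> /allP h; apply/rowP => j; have := h j; rewrite mem_index_enum => /(_ isT).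
by rewrite implyTb sqrf_eq0 mxE => /eqP.
Qed.

Lemma sumsqZ n c (a : 'rV[R]_n) : sumsq (c *: a) = c ^+ 2 * sumsq a.
Proof. by rewrite !sumsqE mulr_sumr; apply: eq_bigr => j _; rewrite mxE exprMn. Qed.

Lemma le_sqrt_sumsq n (a : 'rV[R]_n) j : `|a 0 j| <= Num.sqrt (sumsq a).
Proof.
rewrite -sqrtr_sqr ler_sqrt ?sumsq_ge0 // sumsqE (bigD1 j) //= lerDl.
by rewrite sumr_ge0 // => k _; rewrite sqr_ge0.
Qed.

Lemma sumsq_mul_orthonormal k n (a : 'rV[R]_k) (A : 'M[R]_(k, n)) :
  A *m A^T = 1%:M -> sumsq (a *m A) = sumsq a.
Proof. by move=> AA; rewrite /sumsq trmx_mul -mulmxA (mulmxA A) AA mul1mx. Qed.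

Lemma sumsq_mul_projector k n (a : 'rV[R]_n) (A : 'M[R]_(k, n)) :
  A *m A^T = 1%:M -> sumsq (a *m (1%:M - A^T *m A)) <= sumsq a.
Proof.
move=> AA; have -> : sumsq (a *m (1%:M - A^T *m A)) = sumsq a - sumsq (a *m A^T).
  pose b := a *m A^T; have bT : b^T = A *m a^T by rewrite trmx_mul trmxK.
  have -> : a *m (1%:M - A^T *m A) = a - b *m A by rewrite mulmxBr mulmx1 mulmxA.
  rewrite /sumsq -/b; have -> : (a - b *m A)^T = a^T - A^T *m b^T.
    by rewrite linearB /= trmx_mul.
  have -> : (a - b *m A) *m (a^T - A^T *m b^T) = a *m a^T - b *m b^T.
    rewrite mulmxBl !mulmxBr (mulmxA a) -/b -(mulmxA b A a^T) -bT.
    by rewrite (mulmxA (b *m A)) -(mulmxA b A) AA mulmx1 subrr subr0.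
  by rewrite !mxE.
by rewrite gerBl sumsq_ge0.
Qed.

(* Two block eliminations of [1, A; A^T, 2]. *)
Lemma det_id_add_projector k n (A : 'M[R]_(k, n)) : A *m A^T = 1%:M ->
  2 ^+ k * \det (1%:M + (1%:M - A^T *m A)) = 2 ^+ n.
Proof.
move=> AA; pose M := block_mx 1%:M A A^T (2%:M : 'M[R]_n).
have e1 : \det M = \det (1%:M + (1%:M - A^T *m A)).
  have : \det (M *m block_mx 1%:M (- A) 0 1%:M) = \det M.
    by rewrite det_mulmx det_ublock !det1 !mulr1.
  rewrite mulmx_block !mulmx1 !mulmx0 !addr0 mulmxN mul1mx addNr mulmxN.
  rewrite det_lblock det1 mul1r => <-; congr (\det _).
  by rewrite addrA addrC -scalemx1 scaler_nat mulr2n.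
have e2 : \det M = 2^-1 ^+ k * 2 ^+ n.
  have : \det (M *m block_mx 1%:M 0 (- 2^-1 *: A^T) 1%:M) = \det M.
    by rewrite det_mulmx det_lblock !det1 !mulr1.
  rewrite mulmx_block !mulmx1 !mulmx0 !add0r -scalemxAr AA mul_scalar_mx scalerA.
  rewrite mulrN mulfV ?pnatr_eq0 // scaleN1r subrr det_ublock det_scalar => <-.
  by congr (_ * _); rewrite -{1}[1%:M]scale1r -scalerDl scalemx1 det_scalar; congr (_ ^+ _); field.
by rewrite -e1 e2 mulrA -exprMn mulfV ?pnatr_eq0 // expr1n mul1r.
Qed.

End Sumsq.

Section DvoretzkyRogers.
Variables (R : realType) (X : normedModType R) (n : nat).
Variables (x : 'I_n -> X) (xi : 'I_n -> {scalar X}) (C : R).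
Hypothesis xi_x : forall i j, xi i (x j) = (i == j)%:R.
Hypothesis xi_le : forall i z, `|xi i z| <= C * `|z|.

Definition comb (a : 'rV[R]_n) : X := \sum_j a 0 j *: x j.

Lemma combD a b : comb (a + b) = comb a + comb b.
Proof. by rewrite -big_split; apply: eq_bigr => j _; rewrite mxE scalerDl. Qed.

Lemma combZ c a : comb (c *: a) = c *: comb a.
Proof. by rewrite scaler_sumr; apply: eq_bigr => j _; rewrite mxE scalerA. Qed.

Lemma comb_sum (I : finType) (f : I -> 'rV[R]_n) : comb (\sum_i f i) = \sum_i comb (f i).
Proof.
apply: (big_morph comb combD).
by rewrite /comb big1 // => j _; rewrite mxE scale0r.
Qed.

Lemma xi_comb i a : xi i (comb a) = a 0 i.
Proof.
rewrite linear_sum (bigD1 i) //= linearZ /= xi_x eqxx mulr1 big1 ?addr0 // => j ji.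
by rewrite linearZ /= xi_x eq_sym (negbTE ji) mulr0.
Qed.

(* Rows act on the right: u stands for the operator a |-> comb (a *m u) from l_2^n to X. *)
Definition contractive (u : 'M[R]_n) : Prop :=
  forall a, `|comb (a *m u)| ^+ 2 <= sumsq a.

Lemma contractive_le u a : contractive u -> `|comb (a *m u)| <= Num.sqrt (sumsq a).
Proof.
move=> cu; rewrite -(@ler_pXn2r _ 2) ?nnegrE ?sqrtr_ge0 //.
by rewrite sqr_sqrtr ?sumsq_ge0.
Qed.

(** The functionals [xi] read off the entries of [u], so each entry is at most [C], and the Leibniz
    expansion applies. This makes the supremum of the determinants finite. *)
Lemma contractive_det u : contractive u -> `|\det u| <= \sum_(s : 'S_n) C ^+ n.
Proof.
move=> cu; apply: le_trans (ler_norm_sum _ _ _) _; apply: ler_sum => s _.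
rewrite normrM normrX normrN1 expr1n mul1r normr_prod.
rewrite -[X in C ^+ X](card_ord n) -prodr_const; apply: ler_prod => i _.
rewrite normr_ge0 /=.
have := contractive_le (delta_mx 0 i) cu; rewrite -rowE.
have -> : sumsq (delta_mx 0 i : 'rV[R]_n) = 1.
  rewrite sumsqE (bigD1 i) //= mxE !eqxx expr1n big1 ?addr0 // => j ji.
  by rewrite mxE (negbTE ji) andbF expr0n.
rewrite sqrtr1 => le1.
have := xi_le (s i) (comb (row i u)); rewrite xi_comb mxE => h; apply: le_trans h _.
have C0 : 0 <= C.
  have := xi_le i (x i); rewrite xi_x eqxx normr1 => h.
  rewrite leNgt; apply/negP => Cn.
  have : C * `|x i| <= 0 by rewrite mulr_le0_ge0 // ltW.
  lra.
by rewrite -[leRHS]mulr1 ler_wpM2l.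
Qed.

Lemma contractive_scalar : exists2 c : R, 0 < c & contractive c%:M.
Proof.
pose S := 1 + \sum_j `|x j|.
have S0 : 0 < S by rewrite ltr_pwDl // sumr_ge0.
exists S^-1; first by rewrite invr_gt0.
move=> a; rewrite mul_mx_scalar combZ normrZ exprMn.
rewrite -(sqr_sqrtr (sumsq_ge0 a)) -exprMn ler_pXn2r ?nnegrE ?mulr_ge0 ?sqrtr_ge0 //.
rewrite gtr0_norm ?invr_gt0 // ler_pdivrMl //.
apply: le_trans (ler_norm_sum _ _ _) _.
apply: (@le_trans _ _ (\sum_j Num.sqrt (sumsq a) * `|x j|)).
  by apply: ler_sum => j _; rewrite normrZ ler_wpM2r // le_sqrt_sumsq.
by rewrite -mulr_sumr mulrC ler_wpM2r ?sqrtr_ge0 // lerDr.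
Qed.

(** An approximate maximizer avoids any compactness argument; 9/8 is the gain that [orthogonal_step]
    turns into a contradiction. *)
Lemma almost_maximal_contractive : exists u, [/\ contractive u, 0 < `|\det u| &
  forall v, contractive v -> `|\det v| < 9 / 8 * `|\det u|].
Proof.
pose S := [set `|\det u| | u in [set u | contractive u]].
have [c c0 cc] := contractive_scalar.
have hS : has_sup S.
  split; first by exists `|\det (c%:M : 'M[R]_n)|, c%:M.
  by exists (\sum_(s : 'S_n) C ^+ n) => _ [u /= cu <-]; exact: contractive_det.
have S0 : 0 < sup S.
  apply: (@lt_le_trans _ _ `|\det (c%:M : 'M[R]_n)|).
    by rewrite det_scalar normr_gt0 expf_neq0 // gt_eqF.
  by apply: ub_le_sup; [exact: hS.2 | exists c%:M].
(* The slack sup / 9 leaves |det u| > (8/9) sup. *)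
have e0 : 0 < sup S / 9 by rewrite divr_gt0.
have [_ [u /= cu <-] ltu] := sup_adherent e0 hS.
exists u; split=> //; first by lra.
move=> v cv; have : `|\det v| <= sup S by apply: ub_le_sup; [exact: hS.2 | exists v].
lra.
Qed.

(* Otherwise u is at most 1/3 on the complement of the rows of A, and with P the
   projector onto this complement (3/4) (1 + P) u is still contractive, while its
   determinant is at least (9/16 * 2)^m >= 9/8 times that of u. *)
Lemma orthogonal_step m k (u : 'M[R]_n) (A : 'M[R]_(k, n)) :
  n = (m + m)%N -> (k < m)%N -> contractive u -> 0 < `|\det u| ->
  (forall v, contractive v -> `|\det v| < 9 / 8 * `|\det u|) ->
  A *m A^T = 1%:M ->
  exists z : 'rV[R]_n, [/\ z *m A^T = 0, sumsq z = 1 & 3^-1 <= `|comb (z *m u)|].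
Proof.
move=> nE km cu u0 umax AA; apply: contrapT => nz.
have small z : z *m A^T = 0 -> `|comb (z *m u)| <= 3^-1 * Num.sqrt (sumsq z).
  move=> zA; have [/sumsq_eq0 ->|z0] := eqVneq (sumsq z) 0.
    by rewrite mul0mx /comb big1 ?normr0 ?mulr_ge0 ?invr_ge0 ?sqrtr_ge0 // => j _; rewrite mxE scale0r.
  have s0 : 0 < Num.sqrt (sumsq z) by rewrite sqrtr_gt0 lt_def z0 sumsq_ge0.
  rewrite leNgt; apply/negP => lt; apply: nz.
  exists ((Num.sqrt (sumsq z))^-1 *: z); split.
  - by rewrite -scalemxAl zA scaler0.
  - by rewrite sumsqZ exprVn sqr_sqrtr ?sumsq_ge0 // mulVf.
  by rewrite -scalemxAl combZ normrZ gtr0_norm ?invr_gt0 // ler_pdivlMl // mulrC ltW.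
pose P := 1%:M - A^T *m A.
have cv : contractive ((3 / 4) *: ((1%:M + P) *m u)).
  move=> a; rewrite -scalemxAr combZ mulmxA mulmxDr mulmx1 mulmxDl combD normrZ.
  have h1 := contractive_le a cu.
  have aPA : (a *m P) *m A^T = 0.
    by rewrite -mulmxA mulmxBl mul1mx -mulmxA AA mulmx1 subrr mulmx0.
  have h2 := small _ aPA.
  have h3 : Num.sqrt (sumsq (a *m P)) <= Num.sqrt (sumsq a).
    by rewrite ler_sqrt ?sumsq_ge0 // sumsq_mul_projector.
  rewrite -(sqr_sqrtr (sumsq_ge0 a)) ler_pXn2r ?nnegrE ?sqrtr_ge0 ?mulr_ge0 //.
  have := ler_normD (comb (a *m u)) (comb (a *m P *m u)).
  rewrite ger0_norm; lra.
have := umax _ cv; rewrite detZ det_mulmx 2!normrM ger0_norm ?exprn_ge0 //.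
have d2 := det_id_add_projector AA.
have -> : \det (1%:M + P) = 2 ^+ (n - k).
  apply: (mulfI (x := 2 ^+ k)); first by rewrite expf_neq0 ?pnatr_eq0.
  by rewrite d2 -exprD subnKC // nE (leq_trans (ltnW km)) // leq_addr.
rewrite ger0_norm ?exprn_ge0 // mulrA ltr_pM2r //; apply/negP; rewrite -leNgt.
have h : 2 ^+ m <= 2 ^+ (n - k) :> R.
  by rewrite ler_eXn2l ?ltr1n // nE -addnBA ?leq_addr // ltnW.
apply: (@le_trans _ _ ((3 / 4) ^+ n * 2 ^+ m)); last first.
  by rewrite ler_wpM2l // exprn_ge0.
rewrite nE exprD -!exprMn.
have -> : 3 / 4 * (3 / 4) * 2 = 9 / 8 :> R by field.
case: (m) km => // m' _; rewrite exprS ler_peMr //; apply: exprn_ege1; lra.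
Qed.

(** Orthonormal rows are extracted one at a time by [orthogonal_step], which applies as long as
    fewer than half of the 2 m dimensions are used. The upper bound holds because orthonormal rows
    give an isometry, followed by the contractive [u]. *)
Lemma dvoretzky_rogers m : n = (m + m)%N ->
  exists c : 'I_m -> 'rV[R]_n, (forall i, 3^-1 <= `|comb (c i)|) /\
    forall a : 'I_m -> R, `|\sum_i a i *: comb (c i)| ^+ 2 <= \sum_i a i ^+ 2.
Proof.
move=> nE; have [u [cu u0 umax]] := almost_maximal_contractive.
have [A AA Au] : exists2 A : 'M[R]_(m, n), A *m A^T = 1%:M &
    forall i, 3^-1 <= `|comb (row i A *m u)|.
  have : (m <= m)%N by [].
  elim: {-2}m => [_|k IHk km]; first by exists 0; [apply/matrixP => -[] | case].
  have [A AA Au] := IHk (ltnW km).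
  have [z [zA z1 zu]] := orthogonal_step nE km cu u0 umax AA.
  pose B : 'M[R]_(1 + k, n) := col_mx z A.
  exists B.
    have : B *m B^T = 1%:M :> 'M[R]_(1 + k).
      rewrite tr_col_mx mul_col_row AA zA.
      have -> : A *m z^T = 0 by rewrite -[A]trmxK -trmx_mul zA trmx0.
      have -> : z *m z^T = 1%:M by apply/matrixP => i j; rewrite !ord1 [RHS]mxE; exact: z1.
      by rewrite -scalar_mx_block.
    by [].
  move=> i; case: (split_ordP (i : 'I_(1 + k))) => j ->.
    have -> : row (lshift k j) B = z by rewrite rowKu row_id.
    exact: zu.
  by have -> : row (rshift 1 j) B = row j A by rewrite rowKd.
exists (fun i => row i A *m u); split=> // a.
have -> : \sum_i a i *: comb (row i A *m u) = comb ((\row_i a i) *m A *m u).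
  rewrite (_ : (\row_i a i) *m A *m u = \sum_i a i *: (row i A *m u)).
    by rewrite comb_sum; apply: eq_bigr => i _; rewrite combZ.
  rewrite -mulmxA mulmx_sum_row; apply: eq_bigr => i _.
  by rewrite mxE row_mul.
apply: le_trans (cu _) _.
rewrite sumsq_mul_orthonormal // sumsqE; apply: ler_sum => i _; by rewrite mxE.
Qed.

End DvoretzkyRogers.

(** * Averages over signs *)

Local Notation cube J := {ffun J -> bool}.

Section Averages.
Variable R : realType.
Implicit Types (T J : finType).

Definition avg T (f : T -> R) : R := (\sum_t f t) / #|T|%:R.

Lemma eq_avg T (f g : T -> R) : f =1 g -> avg f = avg g.
Proof. by move=> fg; congr (_ / _); apply: eq_bigr => t _; rewrite fg. Qed.

Lemma avgD T (f g : T -> R) : avg (fun t => f t + g t) = avg f + avg g.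
Proof. by rewrite /avg big_split mulrDl. Qed.

Lemma avgZ T c (f : T -> R) : avg (fun t => c * f t) = c * avg f.
Proof. by rewrite /avg -mulr_sumr mulrA. Qed.

Lemma avgB T (f g : T -> R) : avg (fun t => f t - g t) = avg f - avg g.
Proof. by rewrite /avg sumrB mulrBl. Qed.

Lemma avg_sum T (I : finType) (f : I -> T -> R) :
  avg (fun t => \sum_i f i t) = \sum_i avg (f i).
Proof. by rewrite /avg exchange_big -mulr_suml. Qed.

Lemma le_avg T (f g : T -> R) : (forall t, f t <= g t) -> avg f <= avg g.
Proof. by move=> fg; rewrite ler_wpM2r ?invr_ge0 // ler_sum. Qed.

Lemma avg_ge0 T (f : T -> R) : (forall t, 0 <= f t) -> 0 <= avg f.
Proof. by move=> f0; rewrite divr_ge0 // sumr_ge0. Qed.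

Lemma avg_involutive T (h : T -> T) (f : T -> R) : involutive h -> avg (f \o h) = avg f.
Proof.
move=> hK; rewrite /avg [in RHS](reindex h) //=.
by exists h => t _; rewrite hK.
Qed.

Lemma exchange_avg (S T : finType) (f : S -> T -> R) :
  avg (fun s => avg (f s)) = avg (fun t => avg (f^~ t)).
Proof. by rewrite /avg -!mulr_suml exchange_big mulrAC. Qed.

Lemma cauchy_schwarz_sum T (a b : T -> R) :
  (\sum_t a t * b t) ^+ 2 <= (\sum_t a t ^+ 2) * (\sum_t b t ^+ 2).
Proof.
set A := \sum_t a t ^+ 2; set B := \sum_t b t ^+ 2; set P := \sum_t a t * b t.
have B0 : 0 <= B by rewrite sumr_ge0 // => t _; rewrite sqr_ge0.
have h : 0 <= B * (A * B - P ^+ 2).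
  have -> : B * (A * B - P ^+ 2) = \sum_t (B * a t - P * b t) ^+ 2.
    have -> : \sum_t (B * a t - P * b t) ^+ 2 =
        \sum_t (B ^+ 2 * a t ^+ 2 + (- (2 * B * P)) * (a t * b t) + P ^+ 2 * b t ^+ 2).
      by apply: eq_bigr => t _; ring.
    by rewrite !big_split /= -!mulr_sumr -/A -/B -/P; ring.
  by rewrite sumr_ge0 // => t _; rewrite sqr_ge0.
move: B0; rewrite le_eqVlt => /predU1P[B0|B0]; last by rewrite -subr_ge0 -(pmulr_rge0 _ B0).
have b0 t : b t = 0.
  have /eqP := esym B0; rewrite psumr_eq0 => [|s _]; last by rewrite sqr_ge0.
  by move=> /allP /(_ t); rewrite mem_index_enum => /(_ isT); rewrite implyTb sqrf_eq0 => /eqP.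
by rewrite /P big1 ?expr0n -?B0 ?mulr0 // => t _; rewrite b0 mulr0.
Qed.

Lemma card_cube_gt0 J : 0 < #|{ffun J -> bool}|%:R :> R.
Proof. by rewrite ltr0n; apply/card_gt0P; exists [ffun=> false]. Qed.

Lemma avg_cst J c : avg (fun _ : cube J => c) = c.
Proof.
by rewrite /avg sumr_const -[c *+ _]mulr_natr mulfK // gt_eqF // card_cube_gt0.
Qed.

Lemma variance_avg J (f : cube J -> R) :
  avg (fun e => (f e - avg f) ^+ 2) = avg (fun e => f e ^+ 2) - avg f ^+ 2.
Proof.
have -> : avg (fun e => (f e - avg f) ^+ 2) =
    avg (fun e => f e ^+ 2 - 2 * avg f * f e + avg f ^+ 2).
  by apply: eq_avg => e; ring.
by rewrite avgD avgB avgZ avg_cst; ring.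
Qed.

Lemma sqr_avg_le J (f : cube J -> R) : avg f ^+ 2 <= avg (fun e => f e ^+ 2).
Proof. by rewrite -subr_ge0 -variance_avg avg_ge0 // => e; rewrite sqr_ge0. Qed.

Definition xor_cube J (w e : cube J) : cube J := [ffun j => w j (+) e j].

Lemma xor_cubeK J (w : cube J) : involutive (xor_cube w).
Proof. by move=> e; apply/ffunP => j; rewrite !ffunE addbA addbb. Qed.

Lemma avg_xor J w (f : cube J -> R) : avg (fun e => f (xor_cube w e)) = avg f.
Proof. exact: avg_involutive (xor_cubeK w). Qed.

Definition flip J (j : J) (e : cube J) : cube J := [ffun i => (i == j) (+) e i].

Lemma flipK J (j : J) : involutive (flip j).
Proof. by move=> e; apply/ffunP => i; rewrite !ffunE addbA addbb. Qed.

Lemma flipC J (i j : J) e : flip i (flip j e) = flip j (flip i e).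
Proof. by apply/ffunP => k; rewrite !ffunE addbCA. Qed.

Definition cond_avg J (j : J) (f : cube J -> R) (e : cube J) : R :=
  (f e + f (flip j e)) / 2.

Definition cond_avgs J (s : seq J) (f : cube J -> R) : cube J -> R :=
  foldr (@cond_avg J) f s.

Lemma avg_cond_avg J (j : J) f : avg (cond_avg j f) = avg f.
Proof.
have -> : avg (cond_avg j f) = avg (fun e => 2^-1 * (f e + (f \o flip j) e)).
  by apply: eq_avg => e; rewrite mulrC.
by rewrite avgZ avgD (avg_involutive _ (flipK j)); field.
Qed.

(** The identity a^2 = ((a + b) / 2)^2 + ((a - b) / 2)^2 + (a^2 - b^2) / 2, with b the value after
    the flip; the last term averages to 0. *)
Lemma cond_avg_energy J (j : J) f : avg (fun e => f e ^+ 2) =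
  avg (fun e => cond_avg j f e ^+ 2) + 4^-1 * avg (fun e => (f e - f (flip j e)) ^+ 2).
Proof.
rewrite -avgZ -avgD; apply/eqP; rewrite -subr_eq0 -avgB.
have -> : avg (fun e => f e ^+ 2 - (cond_avg j f e ^+ 2 + 4^-1 * (f e - f (flip j e)) ^+ 2)) =
    avg (fun e => 2^-1 * (f e ^+ 2 - ((fun e => f e ^+ 2) \o flip j) e)).
  by apply: eq_avg => e; rewrite /cond_avg /=; field.
by rewrite avgZ avgB (avg_involutive (fun e => f e ^+ 2) (flipK j)) subrr mulr0.
Qed.

Lemma cond_avgs_contraction J (s : seq J) f :
  avg (fun e => cond_avgs s f e ^+ 2) <= avg (fun e => f e ^+ 2).
Proof.
elim: s => //= j s IHs; apply: le_trans IHs.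
rewrite [leRHS](cond_avg_energy j) lerDl mulr_ge0 // avg_ge0 // => e.
by rewrite sqr_ge0.
Qed.

Lemma cond_avgsB J (s : seq J) j f e : cond_avgs s f e - cond_avgs s f (flip j e) =
  cond_avgs s (fun e => f e - f (flip j e)) e.
Proof.
elim: s e => //= k s IHs e; rewrite /cond_avg -!IHs (flipC k j) -mulrBl; congr (_ / _).
by ring.
Qed.

(** Differences under a flip commute with conditional averages, and these contract the quadratic
    mean, so the loss at each coordinate is at most the one for [f] itself. *)
Lemma cond_avgs_energy J (s : seq J) f : avg (fun e => f e ^+ 2) <=
  avg (fun e => cond_avgs s f e ^+ 2) +
  4^-1 * \sum_(j <- s) avg (fun e => (f e - f (flip j e)) ^+ 2).
Proof.
elim: s => [|j s IHs]; first by rewrite big_nil mulr0 addr0.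
apply: le_trans IHs _; rewrite big_cons mulrDr (cond_avg_energy j) /=.
rewrite -addrA lerD2l lerD2r ler_wpM2l //.
apply: le_trans (cond_avgs_contraction s _).
by apply: le_avg => e; rewrite -cond_avgsB.
Qed.

Lemma cond_avgs_flip J (s : seq J) j f e : j \in s ->
  cond_avgs s f (flip j e) = cond_avgs s f e.
Proof.
elim: s e => //= k s IHs e; rewrite inE => /predU1P[->|js].
  by rewrite /cond_avg flipK addrC.
by rewrite /cond_avg flipC !IHs.
Qed.

Lemma flip_invariant_cst J (g : cube J -> R) :
  (forall j e, g (flip j e) = g e) -> forall e e', g e = g e'.
Proof.
move=> gf e e'.
have fE s : uniq s -> foldr (@flip J) e s = [ffun i => (i \in s) (+) e i].
  elim: s => [|j s IHs] /=; first by move=> _; apply/ffunP => i; rewrite ffunE.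
  move=> /andP[js us]; rewrite IHs //; apply/ffunP => i; rewrite !ffunE inE addbA.
  by case: eqVneq => [->|_] //=; rewrite (negbTE js).
have : g (foldr (@flip J) e (enum [pred j | e j (+) e' j])) = g e.
  by elim: (enum _) => //= j s; rewrite gf.
rewrite fE ?enum_uniq // => <-; congr g; apply/ffunP => i.
by rewrite ffunE mem_enum inE -addbA addbC -addbA addbb addbF.
Qed.

(* Averaging successively over each coordinate turns f into its mean, and each step
   loses at most the corresponding term of the right-hand side. *)
Lemma poincare J (f : cube J -> R) :
  avg (fun e => (f e - avg f) ^+ 2) <=
  4^-1 * \sum_j avg (fun e => (f e - f (flip j e)) ^+ 2).
Proof.
rewrite variance_avg lerBlDl; pose g := cond_avgs (index_enum J) f.
have gc e : g e = avg f.
  have -> : avg f = avg g.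
    by rewrite /g; elim: (index_enum J) => //= j s ->; rewrite avg_cond_avg.
  have gcst := flip_invariant_cst (fun j e => cond_avgs_flip f e (mem_index_enum j)).
  rewrite -(avg_cst J (g e)); apply: eq_avg => e'; exact: gcst.
have -> : avg f ^+ 2 = avg (fun e => g e ^+ 2).
  by rewrite -(avg_cst J (avg f ^+ 2)); apply: eq_avg => e; rewrite gc.
exact: cond_avgs_energy.
Qed.

Definition sg (b : bool) : R := (-1) ^+ b.

Lemma sg_addb b c : sg (b (+) c) = sg b * sg c.
Proof. by rewrite /sg signr_addb. Qed.

Lemma normr_sg b : `|sg b| = 1.
Proof. by rewrite /sg normrX normrN1 expr1n. Qed.

Lemma sg_sq b : sg b ^+ 2 = 1.
Proof. by rewrite /sg sqrr_sign. Qed.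

(** Induction on the support: averaging over the sign of a new index [j] kills the odd powers of its
    term, and c^4 + 6 c^2 S + 3 S^2 <= 3 (c^2 + S)^2. Uniqueness of the indices makes the rest of
    the sum independent of that sign. *)
Lemma moments J (c : J -> R) (s : seq J) : uniq s ->
  avg (fun e : cube J => (\sum_(j <- s) c j * sg (e j)) ^+ 2) = \sum_(j <- s) c j ^+ 2 /\
  avg (fun e : cube J => (\sum_(j <- s) c j * sg (e j)) ^+ 4) <=
    3 * (\sum_(j <- s) c j ^+ 2) ^+ 2.
Proof.
elim: s => [|j s IHs] /=.
  move=> _; split; first by under eq_avg do rewrite big_nil expr0n; rewrite avg_cst big_nil.
  by under eq_avg do rewrite big_nil expr0n; rewrite avg_cst big_nil expr0n mulr0.
move=> /andP[js us]; have [IH2 IH4] := IHs us.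
pose Z (e : cube J) := \sum_(i <- s) c i * sg (e i).
have Zf e : Z (flip j e) = Z e.
  apply: eq_big_seq => i is_; rewrite ffunE.
  by case: eqVneq js => [<-|//]; rewrite is_.
have cf e : c j * sg (flip j e j) = - (c j * sg (e j)).
  by rewrite ffunE eqxx sg_addb /sg expr1; ring.
have E n : avg (fun e : cube J => (\sum_(i <- j :: s) c i * sg (e i)) ^+ n) =
    avg (fun e : cube J => ((c j * sg (e j) + Z e) ^+ n + (- (c j * sg (e j)) + Z e) ^+ n) / 2).
  rewrite -(avg_cond_avg j); apply: eq_avg => e; rewrite /cond_avg !big_cons.
  by rewrite -!/(Z _) Zf cf.
rewrite !E !big_cons; split.
  have -> : avg (fun e : cube J => ((c j * sg (e j) + Z e) ^+ 2 + (- (c j * sg (e j)) + Z e) ^+ 2) / 2)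
      = avg (fun e : cube J => c j ^+ 2 + Z e ^+ 2).
    apply: eq_avg => e; have -> : c j ^+ 2 + Z e ^+ 2 = c j ^+ 2 * sg (e j) ^+ 2 + Z e ^+ 2.
      by rewrite sg_sq mulr1.
    by field.
  by rewrite avgD avg_cst IH2.
have -> : avg (fun e : cube J => ((c j * sg (e j) + Z e) ^+ 4 + (- (c j * sg (e j)) + Z e) ^+ 4) / 2)
    = avg (fun e : cube J => c j ^+ 4 + 6 * c j ^+ 2 * Z e ^+ 2 + Z e ^+ 4).
  apply: eq_avg => e; have -> : c j ^+ 4 + 6 * c j ^+ 2 * Z e ^+ 2 + Z e ^+ 4 =
    c j ^+ 4 * (sg (e j) ^+ 2) ^+ 2 + 6 * c j ^+ 2 * sg (e j) ^+ 2 * Z e ^+ 2 + Z e ^+ 4.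
    by rewrite sg_sq expr1n !mulr1.
  by field.
rewrite 2!avgD avgZ avg_cst IH2.
have : 0 <= c j ^+ 4 by rewrite -[4%N]/(2 * 2)%N exprM sqr_ge0.
move: IH4; rewrite -/Z; nra.
Qed.

Lemma second_moment J (c : J -> R) :
  avg (fun e : cube J => (\sum_j c j * sg (e j)) ^+ 2) = \sum_j c j ^+ 2.
Proof. by have [-> _] := moments c (index_enum_uniq J). Qed.

Lemma first_moment_le J (c : J -> R) :
  avg (fun e : cube J => `|\sum_j c j * sg (e j)|) <= Num.sqrt (\sum_j c j ^+ 2).
Proof.
rewrite -(@ler_pXn2r _ 2) ?nnegrE ?sqrtr_ge0 ?avg_ge0 //.
rewrite sqr_sqrtr ?sumr_ge0 // => [|j _]; last by rewrite sqr_ge0.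
apply: le_trans (sqr_avg_le _) _; rewrite -second_moment; apply: le_avg => e.
by rewrite real_normK // num_real.
Qed.

Lemma khintchine J (c : J -> R) :
  2^-1 * Num.sqrt (\sum_j c j ^+ 2) <= avg (fun e : cube J => `|\sum_j c j * sg (e j)|).
Proof.
set S := \sum_j c j ^+ 2; have S0 : 0 <= S by rewrite sumr_ge0 // => j _; rewrite sqr_ge0.
have [m2 m4] := moments c (index_enum_uniq J); rewrite -/S in m2 m4.
move: S0; rewrite le_eqVlt => /predU1P[<-|S0]; first by rewrite sqrtr0 mulr0 avg_ge0.
set s := Num.sqrt S; have s0 : 0 < s by rewrite sqrtr_gt0.
have sS : S = s ^+ 2 by rewrite sqr_sqrtr // ltW.
(* |u| >= (3 u^2 - u^4) / 2 for u = z / (2 s). *)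
apply: (@le_trans _ _ (avg (fun e : cube J =>
    3 / (4 * s) * (\sum_j c j * sg (e j)) ^+ 2
    - 1 / (16 * s ^+ 3) * (\sum_j c j * sg (e j)) ^+ 4))).
  rewrite avgB !avgZ m2.
  have : 1 / (16 * s ^+ 3) * avg (fun e : cube J => (\sum_j c j * sg (e j)) ^+ 4) <=
      1 / (16 * s ^+ 3) * (3 * S ^+ 2).
    by rewrite ler_wpM2l // divr_ge0 // mulr_ge0 // exprn_ge0 // ltW.
  have -> : 1 / (16 * s ^+ 3) * (3 * S ^+ 2) = 3 / 16 * s.
    by rewrite sS; field; rewrite gt_eqF.
  have -> : 3 / (4 * s) * S = 3 / 4 * s by rewrite sS; field; rewrite gt_eqF.
  lra.
apply: le_avg => e; set z := \sum_j _.
pose u := `|z| / (2 * s); have u0 : 0 <= u by rewrite divr_ge0 // mulr_ge0 // ltW.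
have zu : `|z| = 2 * s * u by rewrite /u; field; rewrite gt_eqF.
rewrite -[z ^+ 2]real_normK ?num_real // -[4%N]/(2 * 2)%N exprM -[z ^+ 2]real_normK ?num_real //.
rewrite -exprM zu -subr_ge0.
have -> : 2 * s * u - (3 / (4 * s) * (2 * s * u) ^+ 2 - 1 / (16 * s ^+ 3) * (2 * s * u) ^+ (2 * 2)) =
    s * (u * (u + 2) * (u - 1) ^+ 2) by field; rewrite gt_eqF.
by rewrite mulr_ge0 ?(ltW s0) // mulr_ge0 ?sqr_ge0 // mulr_ge0 // addr_ge0.
Qed.

End Averages.

(** * Norms of random signed sums *)

Section RademacherSums.
Variables (R : realType) (X : normedModType R).
Implicit Types J I : finType.

Definition rsum J (v : J -> X) (e : cube J) : X := \sum_j sg R (e j) *: v j.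

(** The ell-norm of the operator sending the unit vectors of l_2^J to [v], with signs in place of
    Gaussian variables. *)
Definition ell J (v : J -> X) : R := avg (fun e => `|rsum v e|).

(** [C] bounds the square of the norm of that operator. *)
Definition upper_l2 J (v : J -> X) (C : R) : Prop :=
  forall a : J -> R, `|\sum_j a j *: v j| ^+ 2 <= C * \sum_j a j ^+ 2.

(* By convexity of the norm, sum_j d_j |rsum v (flip j e)| >=
   |sum_j d_j rsum v (flip j e)|, with d_j the positive part being summed. *)
Lemma upper_l2_flips J (v : J -> X) (C : R) (e : cube J) : 0 <= C -> upper_l2 v C ->
  \sum_j (Num.max 0 (`|rsum v e| - `|rsum v (flip j e)|)) ^+ 2 <= 4 * C.
Proof.
move=> C0 vC; pose d j := Num.max 0 (`|rsum v e| - `|rsum v (flip j e)|).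
have d0 j : 0 <= d j by rewrite le_max lexx.
have dsq j : d j * (`|rsum v e| - `|rsum v (flip j e)|) = d j ^+ 2.
  by rewrite /d; case: (leP 0); rewrite ?mul0r ?expr2 // => _; rewrite mulr0.
rewrite -/(d _); set S := \sum_j d j ^+ 2.
have S0 : 0 <= S by rewrite sumr_ge0 // => j _; rewrite sqr_ge0.
have flipE j : rsum v (flip j e) = rsum v e - 2 *: (sg R (e j) *: v j).
  rewrite /rsum (bigD1 j) //= [in RHS](bigD1 j) //= ffunE eqxx sg_addb /sg expr1 mulN1r.
  rewrite (eq_bigr (fun i => (-1) ^+ e i *: v i)) => [|i ij]; last by rewrite ffunE (negbTE ij).
  rewrite scaleNr; set a := _ *: v j; set b := \sum_(i | _) _.
  by rewrite scaler_nat mulr2n opprD addrA (addrAC a b) subrr add0r addrC.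
have S2 : S <= 2 * `|\sum_j (d j * sg R (e j)) *: v j|.
  have -> : S = \sum_j d j * `|rsum v e| - \sum_j d j * `|rsum v (flip j e)|.
    by rewrite -sumrB; apply: eq_bigr => j _; rewrite -dsq mulrBr.
  rewrite lerBlDr.
  have -> : \sum_j d j * `|rsum v e| = `|\sum_j d j *: rsum v e|.
    by rewrite -scaler_suml normrZ -mulr_suml ger0_norm // sumr_ge0.
  have -> : \sum_j d j *: rsum v e =
      2 *: (\sum_j (d j * sg R (e j)) *: v j) + \sum_j d j *: rsum v (flip j e).
    rewrite scaler_sumr -big_split /=; apply: eq_bigr => j _.
    by rewrite flipE scalerBr !scalerA mulrCA addrC -!scalerA subrK.
  apply: le_trans (ler_normD _ _) _; rewrite normrZ ger0_norm //; apply: lerD => //.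
  apply: le_trans (ler_norm_sum _ _ _) _; apply: ler_sum => j _.
  by rewrite normrZ ger0_norm.
have := vC (fun j => d j * sg R (e j)).
rewrite (eq_bigr (fun j => d j ^+ 2)) => [|j _]; last by rewrite exprMn sg_sq mulr1.
rewrite -/S => h.
have {}h : S ^+ 2 <= 4 * C * S.
  apply: le_trans (_ : (2 * `|\sum_j (d j * sg R (e j)) *: v j|) ^+ 2 <= _).
    by rewrite ler_pXn2r ?nnegrE // mulr_ge0.
  by rewrite exprMn -mulrA -natrX ler_wpM2l.
move: S0; rewrite le_eqVlt => /predU1P[<-|S0]; first by rewrite mulr_ge0.
by rewrite -(ler_pM2r S0) -expr2.
Qed.

(** The squared difference under a flip splits into two squared positive parts exchanged by the
    flip, so [upper_l2_flips] gives 4^-1 * 2 * 4 C. The bound involves the operator norm only, not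
    the number of terms. *)
Lemma variance_rsum J (v : J -> X) (C : R) : 0 <= C -> upper_l2 v C ->
  avg (fun e => (`|rsum v e| - ell v) ^+ 2) <= 2 * C.
Proof.
move=> C0 vC; apply: le_trans (poincare _) _.
pose pos j e := (Num.max 0 (`|rsum v e| - `|rsum v (flip j e)|)) ^+ 2.
have E j : avg (fun e => (`|rsum v e| - `|rsum v (flip j e)|) ^+ 2) = 2 * avg (pos j).
  rewrite mulr_natl mulr2n -{2}(avg_involutive (pos j) (flipK j)) -avgD; apply: eq_avg => e.
  rewrite /pos /= flipK; case: (leP 0) => h1; case: (leP 0) => h2; rewrite ?expr0n ?add0r ?addr0 //=.
  - have -> : `|rsum v e| = `|rsum v (flip j e)| by lra.
    by rewrite subrr expr0n addr0.
  - by rewrite -sqrrN opprB.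
  - have -> : `|rsum v e| = `|rsum v (flip j e)| by lra.
    by rewrite subrr expr0n.
rewrite (eq_bigr _ (fun j _ => E j)) -mulr_sumr -avg_sum.
apply: (@le_trans _ _ (4^-1 * (2 * (4 * C)))); last by lra.
rewrite !ler_wpM2l // -[leRHS](avg_cst J); apply: le_avg => e.
exact: upper_l2_flips.
Qed.


(* [r] is a restriction of signs, and [ext] extends signs so that averaging over
   translations by [ext w] makes r e uniform. *)
Lemma avg_marginal J J' (r : cube J -> cube J') (ext : cube J' -> cube J) (f : cube J' -> R) :
  (forall w e, r (xor_cube (ext w) e) = xor_cube w (r e)) ->
  avg (fun e => f (r e)) = avg f.
Proof.
move=> rE.
transitivity (avg (fun w => avg (fun e => f (r (xor_cube (ext w) e))))).
  rewrite -[LHS](avg_cst J'); apply: eq_avg => w.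
  by rewrite (avg_xor (ext w) (fun e => f (r e))).
rewrite exchange_avg -[RHS](avg_cst J); apply: eq_avg => e.
rewrite -(avg_xor (r e)); apply: eq_avg => w; rewrite rE; congr f.
by apply/ffunP => j; rewrite !ffunE addbC addbA addbb.
Qed.

Variable N : nat.

(** A signed sum of this family is the combination with coefficients [d] of N independent copies of
    a signed sum of [u]. For one fixed choice of signs, those copies are the candidates for the
    vectors y_k. *)
Definition copies I (d : 'I_N -> R) (u : I -> X) (p : I * 'I_N) : X := d p.2 *: u p.1.

Definition copy I (u : I -> X) (e : cube (I * 'I_N)%type) (k : 'I_N) : X :=
  \sum_i sg R (e (i, k)) *: u i.

Lemma rsum_copies I d (u : I -> X) e : rsum (copies d u) e = \sum_k d k *: copy u e k.
Proof.
rewrite /rsum /copies /copy.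
transitivity (\sum_i \sum_k sg R (e (i, k)) *: (d k *: u i)).
  by rewrite pair_bigA; apply: eq_bigr => -[].
rewrite exchange_big; apply: eq_bigr => k _; rewrite scaler_sumr.
by apply: eq_bigr => i _; rewrite !scalerA mulrC.
Qed.

Lemma avg_copy I (u : I -> X) k : avg (fun e => `|copy u e k|) = ell u.
Proof.
rewrite /ell -(avg_marginal (r := fun e : cube (I * 'I_N)%type => [ffun i => e (i, k)])
  (ext := fun w : cube I => [ffun p => w p.1])).
  apply: eq_avg => e; congr `| _ |; apply: eq_bigr => i _; by rewrite ffunE.
by move=> w e; apply/ffunP => i; rewrite !ffunE.
Qed.

(* By symmetry h i may be replaced by sg (w i) * |h i| for independent signs w; then
   the average of the norms dominates the norm with |h i| replaced by its mean. *)
Lemma ell_copies_ge I d (u : I -> X) :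
  2^-1 * Num.sqrt (\sum_k d k ^+ 2) * ell u <= ell (copies d u).
Proof.
pose h i (e : cube (I * 'I_N)%type) := \sum_k d k * sg R (e (i, k)).
have rsumE e : rsum (copies d u) e = \sum_i h i e *: u i.
  rewrite rsum_copies /copy.
  under eq_bigr do rewrite scaler_sumr.
  rewrite exchange_big; apply: eq_bigr => i _; rewrite scaler_suml.
  by apply: eq_bigr => k _; rewrite scalerA.
pose kappa := avg (fun w : cube 'I_N => `|\sum_k d k * sg R (w k)|).
have h_avg i : avg (fun e => `|h i e|) = kappa.
  rewrite /kappa -(avg_marginal (r := fun e : cube (I * 'I_N)%type => [ffun k => e (i, k)])
    (ext := fun w : cube 'I_N => [ffun p => w p.2])).
    by apply: eq_avg => e; congr `| _ |; apply: eq_bigr => k _; rewrite ffunE.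
  by move=> w e; apply/ffunP => k; rewrite !ffunE.
apply: (@le_trans _ _ (kappa * ell u)).
  by rewrite ler_wpM2r ?avg_ge0 // khintchine.
have -> : ell (copies d u) =
    avg (fun w : cube I => avg (fun e => `|\sum_i (sg R (w i) * `|h i e|) *: u i|)).
  transitivity (avg (fun w : cube I => avg (fun e => `|\sum_i (sg R (w i) * h i e) *: u i|))).
    rewrite -[LHS](avg_cst I); apply: eq_avg => w.
    rewrite /ell -(avg_xor [ffun p => w p.1]); apply: eq_avg => e.
    rewrite rsumE; congr `| _ |; apply: eq_bigr => i _; congr (_ *: _).
    rewrite /h mulr_sumr; apply: eq_bigr => k _.
    by rewrite !ffunE sg_addb mulrCA.
  rewrite exchange_avg [RHS]exchange_avg; apply: eq_avg => e.
  rewrite -[RHS](avg_xor [ffun i => h i e < 0]); apply: eq_avg => w.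
  congr `| _ |; apply: eq_bigr => i _; congr (_ *: _).
  rewrite ffunE sg_addb ffunE mulrAC mulrC; congr (_ * _).
  by case: ltrgt0P => //= h0; rewrite /sg ?expr0 ?expr1 ?h0; ring.
rewrite -avgZ; apply: le_avg => w.
have -> : kappa * `|rsum u w| = `|\sum_i (sg R (w i) * avg (fun e => `|h i e|)) *: u i|.
  have k0 : 0 <= kappa by rewrite avg_ge0.
  rewrite -{1}(ger0_norm k0) -normrZ scaler_sumr; congr `| _ |; apply: eq_bigr => i _.
  by rewrite h_avg scalerA mulrC.
rewrite /avg ler_pdivlMr ?card_cube_gt0 // -[X in _ * X]normr_nat mulrC -normrZ scaler_sumr.
have -> : \sum_i #|{ffun I * 'I_N -> bool}|%:R *:
    ((sg R (w i) * ((\sum_e `|h i e|) / #|{ffun I * 'I_N -> bool}|%:R)) *: u i) =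
    \sum_e \sum_i (sg R (w i) * `|h i e|) *: u i.
  rewrite exchange_big; apply: eq_bigr => i _; rewrite scalerA mulrCA [_%:R * _]mulrC divfK.
    by rewrite mulr_sumr scaler_suml.
  by rewrite gt_eqF // card_cube_gt0.
exact: ler_norm_sum.
Qed.

(** Coefficients of modulus 1 are absorbed by the symmetry of the signs; the means of two sign
    patterns follow by convexity of the norm. *)
Lemma ell_copies_le I (u : I -> X) d (b b' : 'I_N -> bool) :
  (forall k, d k = (sg R (b k) + sg R (b' k)) / 2) ->
  ell (copies d u) <= ell (copies (fun=> 1) u).
Proof.
move=> dE.
have sgE (c : 'I_N -> bool) :
    ell (copies (fun k => sg R (c k)) u) = ell (copies (fun=> 1) u).
  rewrite /ell -[RHS](avg_xor [ffun p => c p.2]); apply: eq_avg => e.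
  congr `| _ |; apply: eq_bigr => p _.
  by rewrite /copies !ffunE sg_addb scale1r scalerA mulrC.
have -> : ell (copies (fun=> 1) u) = 2^-1 * (ell (copies (fun k => sg R (b k)) u) +
    ell (copies (fun k => sg R (b' k)) u)) by rewrite !sgE; field.
rewrite -avgD -avgZ; apply: le_avg => e.
have -> : rsum (copies d u) e = 2^-1 *: (rsum (copies (fun k => sg R (b k)) u) e +
    rsum (copies (fun k => sg R (b' k)) u) e).
  rewrite -big_split scaler_sumr; apply: eq_bigr => p _.
  rewrite /= /copies !scalerA -scalerDl scalerA dE; congr (_ *: _).
  by field.
by rewrite normrZ ger0_norm // ler_wpM2l // ler_normD.
Qed.

Lemma upper_l2_copies I (u : I -> X) d (C : R) : 0 <= C -> upper_l2 u C ->
  upper_l2 (copies d u) (C * \sum_k d k ^+ 2).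
Proof.
move=> C0 uC a.
have -> : \sum_p a p *: copies d u p = \sum_i (\sum_k a (i, k) * d k) *: u i.
  transitivity (\sum_i \sum_k a (i, k) *: copies d u (i, k)).
    by rewrite pair_bigA; apply: eq_bigr => -[].
  apply: eq_bigr => i _; rewrite scaler_suml; apply: eq_bigr => k _.
  by rewrite /copies scalerA.
apply: le_trans (uC _) _; rewrite -mulrA ler_wpM2l // mulrC.
have -> : \sum_p a p ^+ 2 = \sum_i \sum_k a (i, k) ^+ 2.
  by rewrite pair_bigA; apply: eq_bigr => -[].
rewrite mulr_suml; apply: ler_sum => i _.
exact: cauchy_schwarz_sum.
Qed.

End RademacherSums.

(** * Large averages produced by rows of equal signs *)

Section LargeAverage.
Variables (R : realType) (X : normedModType R) (m L : nat).

Definition constant_row (e : cube ('I_m * 'I_L.+1)%type) (i : 'I_m) : bool :=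
  [forall l, e (i, l) == e (i, ord0)].

Definition some_row (e : cube ('I_m * 'I_L.+1)%type) : option 'I_m :=
  [pick i | constant_row e i].

(* This involution keeps the constant row i only, so that the sums at e and at
   [flip_other_rows e] add up to 2 c L.+1 times +- b i. *)
Definition flip_other_rows (e : cube ('I_m * 'I_L.+1)%type) : cube ('I_m * 'I_L.+1)%type :=
  if some_row e is Some i then xor_cube [ffun p => p.1 != i] e else e.

Lemma constant_row_flip e : constant_row (flip_other_rows e) =1 constant_row e.
Proof.
rewrite /flip_other_rows; case: some_row => // k i; rewrite /constant_row.
apply: eq_forallb => l; rewrite !ffunE /=; case: (i != k) => //=.
exact: (inj_eq (can_inj negbK)).
Qed.

Lemma some_row_flip e : some_row (flip_other_rows e) = some_row e.
Proof. by apply: eq_pick; exact: constant_row_flip. Qed.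

Lemma flip_other_rowsK : involutive flip_other_rows.
Proof.
move=> e; rewrite {1}/flip_other_rows some_row_flip /flip_other_rows.
by case: some_row => // i; exact: xor_cubeK.
Qed.

Lemma no_constant_row : avg (fun e => (some_row e == None)%:R : R) <= (1 - 2^-1 ^+ L.+1) ^+ m.
Proof.
(* A nonconstant row differs in particular from the all-[false] one; excluding this single pattern
   gives the bound. *)
pose NC : {set cube 'I_L.+1} := [set~ [ffun=> false]]%SET.
pose curry_rows (e : cube ('I_m * 'I_L.+1)%type) : {ffun 'I_m -> cube 'I_L.+1} :=
  [ffun i => [ffun l => e (i, l)]].
have inj : injective curry_rows.
  move=> e e' /ffunP h; apply/ffunP => -[i l].
  by have := h i; rewrite !ffunE => /ffunP /(_ l); rewrite !ffunE.
have leq : (#|[set e | some_row e == None]%SET| <= #|NC| ^ m)%N.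
  have -> : (#|NC| ^ m)%N = #|[pred f : {ffun 'I_m -> cube 'I_L.+1} | f \in ffun_on (mem NC)]|.
    by rewrite -[RHS]/#|ffun_on _| card_ffun_on card_ord.
  rewrite -(card_imset _ inj); apply: subset_leq_card.
  apply/fintype.subsetP => _ /imsetP[e + ->]; rewrite inE => /eqP; rewrite /some_row.
  case: pickP => // nc _; apply/ffun_onP => i; rewrite !inE; apply/eqP => /ffunP h.
  have := nc i; rewrite /constant_row => /negP; apply; apply/forallP => l.
  by have := h l; have := h ord0; rewrite !ffunE => -> ->.
have cardNC : #|NC| = (2 ^ L.+1 - 1)%N.
  by rewrite cardsC1 card_ffun card_bool card_ord subn1.
rewrite /avg ler_pdivrMr ?card_cube_gt0 //.
rewrite card_ffun card_bool card_prod !card_ord.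
have -> : \sum_e (some_row e == None)%:R = #|[set e | some_row e == None]%SET|%:R :> R.
  by rewrite -sum1_card natr_sum [RHS]big_mkcond; apply: eq_bigr => e _; rewrite inE; case: ifP.
apply: (@le_trans _ _ ((#|NC| ^ m)%N%:R)); first by rewrite ler_nat.
rewrite cardNC mulnC expnM !natrX -exprMn natrB ?expn_gt0 // natrX.
by rewrite mulrBl mul1r -exprMn mulVf ?pnatr_eq0 // expr1n.
Qed.

(** With probability at least 1/2 some row has equal signs. It contributes a vector of norm at least
    c r (L + 1), and averaging with [flip_other_rows] removes the other rows. *)
Lemma ell_copies_large (b : 'I_m -> X) (c r : R) : 0 <= c -> (forall i, r <= `|b i|) ->
  (1 - 2^-1 ^+ L.+1) ^+ m <= 2^-1 :> R -> 0 <= r ->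
  c * r * L.+1%:R / 2 <= ell (copies (fun _ : 'I_L.+1 => c) b).
Proof.
move=> c0 br pm r0; set v := copies _ b.
have h e : c * r * L.+1%:R * (1 - (some_row e == None)%:R) <=
    2^-1 * (`|rsum v e| + `|rsum v (flip_other_rows e)|).
  case E: (some_row e) => [i|] /=; last first.
    by rewrite subrr mulr0 mulr_ge0 // addr_ge0.
  rewrite subr0 mulr1.
  have -> : c * r * L.+1%:R = 2^-1 * (2 * (c * L.+1%:R) * r) by field.
  rewrite ler_wpM2l //; apply: le_trans (ler_normD _ _).
  have -> : rsum v e + rsum v (flip_other_rows e) =
      (2 * (c * (L.+1%:R * sg R (e (i, ord0))))) *: b i.
    have vE e' : rsum v e' = c *: \sum_j (\sum_l sg R (e' (j, l))) *: b j.
      rewrite rsum_copies -scaler_sumr /copy exchange_big; congr (_ *: _).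
      by apply: eq_bigr => j _; rewrite scaler_suml.
    rewrite !vE -scalerDr -big_split /= (bigD1 i) //= [X in _ *: (_ + X)]big1 ?addr0 => [|j ji].
      rewrite -scalerDl scalerA; congr (_ *: _).
      have ci l : e (i, l) = e (i, ord0).
        move: E; rewrite /some_row; case: pickP => // k /forallP h [<-].
        exact/eqP.
      rewrite -big_split (eq_bigr (fun=> 2 * sg R (e (i, ord0)))) => [|l _].
        by rewrite sumr_const card_ord -mulr_natr; ring.
      rewrite /flip_other_rows E ffunE ffunE /= eqxx /= ci; ring.
    rewrite -scalerDl -big_split big1 ?scale0r // => l _.
    rewrite /flip_other_rows E ffunE ffunE /= ji /= /sg signrN; exact: subrr.
  rewrite normrZ !normrM normr_sg mulr1 !normr_nat ger0_norm // -!mulrA.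
  by rewrite !ler_wpM2l.
have : avg (fun e => c * r * L.+1%:R * (1 - (some_row e == None)%:R)) <=
    avg (fun e => 2^-1 * (`|rsum v e| + `|rsum v (flip_other_rows e)|)) by exact: le_avg.
rewrite !avgZ avgB avg_cst avgD.
rewrite (avg_involutive (fun e => `|rsum v e|) flip_other_rowsK) -/(ell v).
have := no_constant_row.
have : 0 <= c * r * L.+1%:R by rewrite !mulr_ge0.
nra.
Qed.

End LargeAverage.

(** * Vectors that are Euclidean on small integer coefficients *)

Section CubeVectors.
Variables (R : realType) (X : normedModType R) (tau : {scalar X}).
Hypothesis biorthogonal_systems : forall n, exists (x : 'I_n -> X) (xi : 'I_n -> {scalar X}) (C : R),
  [/\ forall i j, xi i (x j) = (i == j)%:R, forall i, tau (x i) = 0 &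
      forall i z, `|xi i z| <= C * `|z|].

(** Sums of L + 1 signs with weight 1 / sqrt (L + 1) imitate Gaussian variables: the l_2 bound stays
    1 while the average reaches sqrt (L + 1) / 6. Single signs would not do, since the unit vectors
    of c_0 have average 1. *)
Lemma large_ell (U : R) : 0 <= U -> exists (J : finType) (v : J -> X),
  [/\ upper_l2 v 1, forall j, tau (v j) = 0 & U <= ell v].
Proof.
move=> U0.
have [L hL] : exists L : nat, 6 * U <= Num.sqrt L.+1%:R.
  exists (Num.truncn ((6 * U) ^+ 2)).
  rewrite -(@ler_pXn2r _ 2) ?nnegrE ?sqrtr_ge0 ?mulr_ge0 // sqr_sqrtr //.
  by rewrite ltW // truncnS_gt // sqr_ge0.
have [m hm] : exists m : nat, (1 - 2^-1 ^+ L.+1) ^+ m <= 2^-1 :> R.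
  have p0 : 0 < 2^-1 ^+ L.+1 :> R by rewrite exprn_gt0.
  have p1 : 2^-1 ^+ L.+1 <= 1 :> R by rewrite exprn_ile1 // invf_le1 // ler1n.
  have /cvgr0_norm_lt : (fun n => (1 - 2^-1 ^+ L.+1) ^+ n : R) @ \oo --> (0 : R).
    by apply: cvg_expr; rewrite ger0_norm; lra.
  have h0 : 0 < 2^-1 :> R by rewrite invr_gt0.
  move=> /(_ _ h0) [m _ /(_ m (leqnn m))] h.
  by exists m; apply: ltW; apply: le_lt_trans h; exact: ler_norm.
have [x [xi [C [xi_x tau_x xi_le]]]] := biorthogonal_systems (m + m).
have [c [c_ge c_le]] := dvoretzky_rogers xi_x xi_le erefl.
pose d : R := (Num.sqrt L.+1%:R)^-1.
have s0 : 0 < Num.sqrt L.+1%:R :> R by rewrite sqrtr_gt0 ltr0n.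
have sq : (Num.sqrt L.+1%:R) ^+ 2 = L.+1%:R :> R by rewrite sqr_sqrtr.
exists ('I_m * 'I_L.+1)%type, (copies (fun=> d) (fun i => comb x (c i))); split.
- have -> : 1 = 1 * \sum_(k < L.+1) d ^+ 2.
    by rewrite mul1r sumr_const card_ord -mulr_natr exprVn sq mulVf // pnatr_eq0.
  by apply: upper_l2_copies => // a; rewrite mul1r.
- move=> p; rewrite linearZ /= linear_sum big1 ?mulr0 // => j _.
  by rewrite linearZ /= tau_x mulr0.
apply: (@le_trans _ _ (d * 3^-1 * L.+1%:R / 2)); last first.
  by apply: ell_copies_large => //; rewrite invr_ge0 ltW.
rewrite -sq; have -> : d * 3^-1 * Num.sqrt L.+1%:R ^+ 2 / 2 = Num.sqrt L.+1%:R / 6.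
  by rewrite /d; field; rewrite gt_eqF.
lra.
Qed.

(** A crude upper bound for [ell], from an expansion in fixed vectors [w]. Its merit is to grow by
    sqrt N under N copies, however [ell] itself behaves. *)
Definition coordinate_bound (I : finType) (u : I -> X) (q : R) : Prop :=
  exists (K : finType) (w : K -> X) (c : K -> I -> R),
    (forall i, u i = \sum_l c l i *: w l) /\
    \sum_l Num.sqrt (\sum_i c l i ^+ 2) * `|w l| <= q.

Lemma ell_le_coordinate_bound (I : finType) (u : I -> X) q : coordinate_bound u q -> ell u <= q.
Proof.
move=> [K [w [c [uE]]]]; apply: le_trans.
apply: (@le_trans _ _ (avg (fun e : cube I => \sum_l `|\sum_i c l i * sg R (e i)| * `|w l|))).
  apply: le_avg => e.
  have -> : rsum u e = \sum_l (\sum_i c l i * sg R (e i)) *: w l.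
    rewrite /rsum; under eq_bigr do rewrite uE scaler_sumr.
    rewrite exchange_big; apply: eq_bigr => l _; rewrite scaler_suml.
    by apply: eq_bigr => i _; rewrite scalerA mulrC.
  apply: le_trans (ler_norm_sum _ _ _) _; apply: ler_sum => l _.
  by rewrite normrZ.
rewrite avg_sum; apply: ler_sum => l _.
under eq_avg do rewrite mulrC.
by rewrite avgZ mulrC ler_wpM2r // first_moment_le.
Qed.

Lemma coordinate_bound_copies N (I : finType) (u : I -> X) q : coordinate_bound u q ->
  coordinate_bound (copies (fun _ : 'I_N => 1) u) (Num.sqrt N%:R * q).
Proof.
move=> [K [w [c [uE cq]]]]; exists K, w, (fun l p => c l p.1); split.
  by move=> p; rewrite /copies scale1r uE.
apply: le_trans (_ : Num.sqrt N%:R * (\sum_l Num.sqrt (\sum_i c l i ^+ 2) * `|w l|) <= _); last first.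
  by rewrite ler_wpM2l // sqrtr_ge0.
rewrite mulr_sumr; apply: ler_sum => l _; rewrite mulrA ler_wpM2r //.
have -> : \sum_(p : I * 'I_N) c l p.1 ^+ 2 = \sum_i \sum_(k < N) c l i ^+ 2.
  by rewrite pair_bigA.
under eq_bigr do rewrite sumr_const card_ord -mulr_natl.
by rewrite -mulr_sumr sqrtrM.
Qed.

(* Passing to N copies multiplies the coordinate bound by sqrt N; if it always
   multiplied [ell] by more than 2 sqrt N, iterating it would contradict
   [ell_le_coordinate_bound]. *)
Lemma stable_ell N (U : R) : (0 < N)%N -> 0 < U -> exists (I : finType) (u : I -> X) (C : R),
  [/\ 0 < C, upper_l2 u C, forall i, tau (u i) = 0, U * Num.sqrt C <= ell u &
      ell (copies (fun _ : 'I_N => 1) u) <= 2 * Num.sqrt N%:R * ell u].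
Proof.
move=> N0 U0; apply: contrapT => none.
have [J [v [v1 tv vU]]] := large_ell (ltW U0).
have s0 : 0 < Num.sqrt N%:R :> R by rewrite sqrtr_gt0 ltr0n.
have [q vq] : exists q, coordinate_bound v q.
  eexists; exists J, v, (fun l i => (l == i)%:R); split; last exact: lexx.
  move=> i; rewrite (bigD1 i) //= eqxx scale1r big1 ?addr0 // => l li.
  by rewrite (negbTE li) scale0r.
have H n : exists (I : finType) (u : I -> X) (C : R),
  [/\ 0 < C, upper_l2 u C, forall i, tau (u i) = 0, U * Num.sqrt C <= ell u &
      coordinate_bound u (Num.sqrt N%:R ^+ n * q) /\ (2 * Num.sqrt N%:R) ^+ n * ell v <= ell u].
  elim: n => [|n [I [u [C [C0 uC tu uU [uq un]]]]]].
    by exists J, v, 1; split=> //; rewrite ?sqrtr1 ?mulr1 ?expr0 ?mul1r.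
  have big : 2 * Num.sqrt N%:R * ell u < ell (copies (fun _ : 'I_N => 1) u).
    by rewrite ltNge; apply/negP => le; apply: none; exists I, u, C.
  have eu0 : 0 <= ell u by rewrite avg_ge0.
  exists (I * 'I_N)%type, (copies (fun _ : 'I_N => 1) u), (C * N%:R); split.
  - by rewrite mulr_gt0 // ltr0n.
  - have -> : N%:R = \sum_(k < N) 1 ^+ 2 :> R.
      by rewrite (eq_bigr (fun=> 1)) ?sumr_const ?card_ord // => k _; rewrite expr1n.
    by apply: upper_l2_copies => //; exact: ltW.
  - by move=> p; rewrite /copies linearZ /= tu mulr0.
  - apply: le_trans (ltW big); rewrite sqrtrM ?(ltW C0) // mulrA.
    have : 0 <= Num.sqrt C by rewrite sqrtr_ge0.
    nra.
  - split; first by rewrite exprS -mulrA; exact: coordinate_bound_copies.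
    apply: le_trans (ltW big); rewrite exprS -mulrA ler_wpM2l // mulr_ge0 ?(ltW s0) //.
have ev0 : 0 < ell v by apply: lt_le_trans vU.
have pw n : 2 ^+ n * ell v <= q.
  have [I [u [C [_ _ _ _ [/ell_le_coordinate_bound uq un]]]]] := H n.
  rewrite -(ler_pM2l (exprn_gt0 n s0)); apply: le_trans uq; apply: le_trans un.
  by rewrite exprMn mulrA (mulrC (2 ^+ n)).
pose n := Num.truncn (q / ell v).
have := pw n.+1; rewrite -ler_pdivlMr // leNgt => /negP; apply.
apply: (@lt_trans _ _ n.+1%:R).
  have q0 : 0 <= q by apply: le_trans (pw 0%N); rewrite mulr_ge0 ?ltW.
  by rewrite truncnS_gt // divr_ge0 // ltW.
by rewrite -natrX ltr_nat ltn_expl.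
Qed.

Definition small_int (n : nat) (x : R) : Prop := exists2 i, (i <= n.*2)%N & x = i%:R - n%:R.

(** This is the form of the coefficients required by [ell_copies_le]. *)
Lemma small_int1_signs (x : R) : small_int 1 x ->
  x = (sg R (x < 0)%R + sg R (x <= 0)%R) / 2.
Proof.
move=> [[|[|[|//]]] _ ->]; rewrite /sg.
- have -> : (0%:R - 1%:R < 0 :> R) by lra.
  have -> : (0%:R - 1%:R <= 0 :> R) by lra.
  by rewrite expr1; field.
- have -> : (1%:R - 1%:R < 0 :> R) = false by rewrite subrr ltxx.
  have -> : (1%:R - 1%:R <= 0 :> R) by lra.
  by rewrite expr0 expr1; field.
have -> : (2%:R - 1%:R < 0 :> R) = false by apply/negbTE; rewrite -leNgt; lra.
have -> : (2%:R - 1%:R <= 0 :> R) = false by apply/negbTE; rewrite -ltNge; lra.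
by rewrite expr0; field.
Qed.

(* Chebyshev's inequality for the 5^N coefficient vectors at once: [stable_ell] makes
   the mean as large as wanted compared with the standard deviation. *)
Lemma cube_vectors N : (0 < N)%N -> exists y : 'I_N -> X,
  [/\ forall k, tau (y k) = 0, forall k, `|y k| <= 6,
      forall d : 'I_N -> R, (forall k, small_int 1 (d k)) -> `|\sum_k d k *: y k| <= 12 * Num.sqrt N%:R &
      forall d : 'I_N -> R, (forall k, small_int 2 (d k)) ->
        \sum_k d k ^+ 2 <= `|\sum_k d k *: y k| ^+ 2].
Proof.
(* Each of the [B] coefficient vectors fails with probability at most 32 / U^2, and B * 32 / (33
   B)^2 < 1. *)
move=> N0; pose B := #|{ffun 'I_N -> 'I_5}|; pose U : R := 33 * B%:R.
have B1 : 1 <= B%:R :> R by rewrite ler1n /B card_ffun expn_gt0 card_ord.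
have U0 : 0 < U by rewrite mulr_gt0 // (lt_le_trans ltr01).
have [I [u [C [C0 uC tu uU un]]]] := stable_ell N0 U0.
have eu0 : 0 < ell u by apply: lt_le_trans uU; rewrite mulr_gt0 // sqrtr_gt0.
pose dv (d : {ffun 'I_N -> 'I_5}) (k : 'I_N) : R := (d k)%:R - 2.
pose S d := \sum_k dv d k ^+ 2.
pose M d := ell (copies (dv d) u).
have Mge d : 2^-1 * Num.sqrt (S d) * ell u <= M d by exact: ell_copies_ge.
have S0 d : 0 <= S d by rewrite sumr_ge0 // => k _; rewrite sqr_ge0.
have var d : avg (fun e => (`|rsum (copies (dv d) u) e| - M d) ^+ 2 / (M d / 2) ^+ 2) <= 32 / U ^+ 2.
  under eq_avg do rewrite mulrC.
  rewrite avgZ.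
  have h1 := variance_rsum (mulr_ge0 (ltW C0) (S0 d)) (upper_l2_copies (dv d) (ltW C0) uC).
  (* For d = 0 the variance bound is 0, so the value of the inverse in front does not matter. *)
  have [Sd0|Sd0] := eqVneq (S d) 0.
    move: h1; rewrite Sd0 !mulr0 => h1.
    apply: (@le_trans _ _ 0); last by rewrite divr_ge0 // sqr_ge0.
    by rewrite mulr_ge0_le0 // invr_ge0 sqr_ge0.
  have Sd : 0 < S d by rewrite lt_def Sd0 S0.
  have sS : 0 < Num.sqrt (S d) by rewrite sqrtr_gt0.
  have M0 : 0 < M d by apply: lt_le_trans (Mge d); rewrite mulr_gt0 // mulr_gt0 // invr_gt0.
  have M2 : 0 < (M d / 2) ^+ 2 by rewrite exprn_gt0 // divr_gt0.
  rewrite (ler_pdivrMl _ _ M2); apply: le_trans h1 _.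
  have MU : 2^-1 * Num.sqrt (S d) * (U * Num.sqrt C) <= M d.
    by apply: le_trans (Mge d); rewrite ler_wpM2l // mulr_ge0 // ltW.
  have MU2 : (2^-1 * Num.sqrt (S d) * (U * Num.sqrt C)) ^+ 2 <= M d ^+ 2.
    by rewrite ler_pXn2r ?nnegrE // ?(ltW M0) // !mulr_ge0 ?sqrtr_ge0 // ltW.
  have -> : (M d / 2) ^+ 2 * (32 / U ^+ 2) = 8 * M d ^+ 2 / U ^+ 2 by field; rewrite gt_eqF.
  rewrite ler_pdivlMr ?exprn_gt0 //.
  have -> : 2 * (C * S d) * U ^+ 2 = 8 * (2^-1 * Num.sqrt (S d) * (U * Num.sqrt C)) ^+ 2.
    by rewrite !exprMn !sqr_sqrtr ?(ltW C0) // exprVn; field.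
  by rewrite ler_wpM2l.
have [e He] : exists e, forall d, (`|rsum (copies (dv d) u) e| - M d) ^+ 2 / (M d / 2) ^+ 2 < 1.
  apply: contrapT => none.
  have : 1 <= avg (fun e => \sum_d (`|rsum (copies (dv d) u) e| - M d) ^+ 2 / (M d / 2) ^+ 2).
    rewrite -[leLHS](avg_cst (I * 'I_N)%type); apply: le_avg => e; rewrite leNgt; apply/negP => lt.
    apply: none; exists e => d; apply: le_lt_trans lt; rewrite (bigD1 d) //= lerDl.
    by rewrite sumr_ge0 // => d' _; rewrite divr_ge0 // sqr_ge0.
  rewrite avg_sum; apply/negP; rewrite -ltNge.
  apply: (@le_lt_trans _ _ (\sum_(d : {ffun 'I_N -> 'I_5}) 32 / U ^+ 2)).
    by apply: ler_sum => d _; exact: var.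
  rewrite sumr_const -[(_ / _) *+ _]mulr_natr -/B mulrAC ltr_pdivrMr ?exprn_gt0 // mul1r /U.
  by move: B1; nra.
have He2 d : 0 < M d -> M d / 2 <= `|rsum (copies (dv d) u) e| <= 3 / 2 * M d.
  move=> M0; have := He d.
  have M2 : 0 < (M d / 2) ^+ 2 by rewrite exprn_gt0 // divr_gt0.
  rewrite (ltr_pdivrMr _ _ M2) mul1r.
  rewrite -[X in X < _]real_normK ?num_real // ltr_pXn2r ?nnegrE // ?(ltW (divr_gt0 M0 (ltr0Sn _ 1))) //.
  rewrite ltr_norml => /andP[h1 h2]; apply/andP; split; lra.
(* The factor 4 compensates 1/2 from Chebyshev and 1/2 from [ell_copies_ge] in the lower bound; the
   upper bounds become 4 * 3/2 = 6 and 4 * 3/2 * 2 = 12. *)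
pose y k := (4 / ell u) *: copy u e k.
have yE (f : 'I_N -> R) : `|\sum_k f k *: y k| = 4 / ell u * `|rsum (copies f u) e|.
  have q0 : 0 <= 4 / ell u by rewrite ltW // divr_gt0.
  rewrite rsum_copies -[X in X * _](ger0_norm q0) -normrZ scaler_sumr.
  by congr `| _ |; apply: eq_bigr => k _; rewrite !scalerA mulrC.
have dvE (d : 'I_N -> R) : (forall k, small_int 2 (d k)) -> exists d', d = dv d'.
  move=> ds; have H k : exists i : 'I_5, d k = i%:R - 2.
    by have [i i4 ->] := ds k; exists (Ordinal (i4 : (i < 5)%N)).
  have [f fE] := choice H.
  by exists [ffun k => f k]; apply/funext => k; rewrite /dv ffunE.
have M_pos d : S d != 0 -> 0 < M d.
  move=> Sd0; apply: lt_le_trans (Mge d); rewrite mulr_gt0 // mulr_gt0 // ?invr_gt0 //.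
  by rewrite sqrtr_gt0 lt_def Sd0 S0.
have S_eq0 (d : 'I_N -> R) k : \sum_k d k ^+ 2 = 0 -> d k = 0.
  move=> /eqP; rewrite psumr_eq0 => [|j _]; last by rewrite sqr_ge0.
  by move=> /allP /(_ k); rewrite mem_index_enum => /(_ isT); rewrite implyTb sqrf_eq0 => /eqP.
exists y; split.
- move=> k; rewrite linearZ /= linear_sum big1 ?mulr0 // => i _.
  by rewrite linearZ /= tu mulr0.
- move=> k; pose d (j : 'I_N) : R := (j == k)%:R.
  have [d' d'E] : exists d', d = dv d'.
    apply: dvE => j; rewrite /d; case: (j == k); [exists 3%N|exists 2%N] => //=; lra.
  have -> : y k = \sum_j d j *: y j.
    by rewrite (bigD1 k) //= /d eqxx scale1r big1 ?addr0 // => j /negbTE ->; rewrite scale0r.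
  have rc e' : rsum (copies d u) e' = copy u e' k.
    rewrite rsum_copies (bigD1 k) //= /d eqxx scale1r big1 ?addr0 // => j /negbTE ->.
    by rewrite scale0r.
  have Mk : M d' = ell u.
    by rewrite /M -d'E -(avg_copy u k); apply: eq_avg => e'; rewrite rc.
  rewrite yE d'E.
  have /andP[_ h] : M d' / 2 <= `|rsum (copies (dv d') u) e| <= 3 / 2 * M d'.
    by apply: He2; rewrite Mk.
  rewrite mulrAC ler_pdivrMr //; move: h; rewrite Mk; lra.
- move=> d ds.
  have d2 k : small_int 2 (d k).
    by have [i i2 ->] := ds k; exists i.+1; [exact: (leq_trans (n := 3)) | rewrite -natr1; lra].
  have [d' d'E] := dvE _ d2.
  have Mle : M d' <= 2 * Num.sqrt N%:R * ell u.
    apply: le_trans un; rewrite /M -d'E.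
    by apply: ell_copies_le => k; apply: small_int1_signs.
  rewrite yE d'E; have [Sd|/M_pos M0] := eqVneq (S d') 0.
    rewrite /rsum big1 ?normr0 ?mulr0 ?mulr_ge0 ?sqrtr_ge0 // => p _.
    by rewrite /copies (S_eq0 _ _ Sd) scale0r scaler0.
  have /andP[_ h] := He2 _ M0.
  rewrite mulrAC ler_pdivrMr //; apply: le_trans (_ : 4 * (3 / 2 * (2 * Num.sqrt N%:R * ell u)) <= _).
    by rewrite ler_wpM2l //; apply: le_trans h _; rewrite ler_wpM2l.
  lra.
- move=> d ds; have [d' ->] := dvE _ ds; rewrite yE -/(S d').
  have [->|Sd] := eqVneq (S d') 0; first exact: sqr_ge0.
  have M0 := M_pos _ Sd; have /andP[h _] := He2 _ M0.
  rewrite -[leLHS](sqr_sqrtr (S0 d')) ler_pXn2r ?nnegrE ?sqrtr_ge0 ?mulr_ge0 ?invr_ge0 ?(ltW eu0) //.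
  rewrite mulrAC ler_pdivlMr //; have := Mge d'; move: h; lra.
Qed.

End CubeVectors.

(** * Tsarkov's obstruction *)

Section Tsarkov.
Variables (R : realType) (N : nat).
Notation grid := {ffun 'I_N -> 'I_3}.

Definition grid_val (i : 'I_3) : R := i%:R - 1.

Definition upd (k : 'I_N) (v : 'I_3) (e : grid) : grid :=
  [ffun j => if j == k then v else e j].

Lemma sum_upd (F : grid -> R) k : \sum_e \sum_v F (upd k v e) = 3 * \sum_e F e.
Proof.
(* Addition in ['I_3] is modulo 3, so for fixed [i] this permutes the grid. *)
pose rot (i : 'I_3) (e : grid) := upd k (e k + i) e.
have rotK i : cancel (rot i) (rot (- i)).
  move=> e; apply/ffunP => j; rewrite !ffunE eqxx addrK.
  by case: eqP => [->|].
transitivity (\sum_e \sum_i F (rot i e)).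
  apply: eq_bigr => e _; rewrite (reindex (fun i : 'I_3 => e k + i)) //=.
  by exists (fun i => i - e k) => i _; [rewrite addrC addKr | rewrite addrC subrK].
rewrite exchange_big /=.
have -> : 3 * \sum_e F e = \sum_(i : 'I_3) \sum_e F e.
  by rewrite sumr_const card_ord mulr_natl.
apply: eq_bigr => i _; rewrite [RHS](reindex (rot i)) //.
exists (rot (- i)) => e _; first exact: rotK.
by have := rotK (- i) e; rewrite opprK.
Qed.

(** On each line of three grid points the errors have a second difference of modulus at least 2 s -
    beta, so their squares sum to at least an eighth of its square. Each point is counted 3 times
    per direction, whence 24 = 3 * 8. Summing over directions gives the factor [N] on the left
    only. *)
Lemma grid_approximation (h : grid -> 'I_N -> R) (s eta beta : R) :
  0 <= s -> beta <= 2 * s ->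
  (forall e : grid, \sum_k (h e k - s * `|grid_val (e k)|) ^+ 2 <= eta ^+ 2) ->
  (forall (e : grid) k, e k = 1 -> `|h (upd k 2 e) k + h (upd k 0 e) k - 2 * h e k| <= beta) ->
  N%:R * (2 * s - beta) ^+ 2 <= 24 * eta ^+ 2.
Proof.
move=> s0 bs happ hsec.
pose err e k := h e k - s * `|grid_val (e k)|.
have step e k : (2 * s - beta) ^+ 2 <= 8 * \sum_v err (upd k v e) k ^+ 2.
  have := hsec (upd k 1 e) k; rewrite ffunE eqxx => /(_ erefl).
  have uu v : upd k v (upd k 1 e) = upd k v e.
    by apply/ffunP => j; rewrite !ffunE; case: eqP.
  rewrite !uu => hD.
  have E (v : 'I_3) : h (upd k v e) k = err (upd k v e) k + s * `|v%:R - 1|.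
    by rewrite /err /grid_val ffunE eqxx subrK.
  move: hD; rewrite !E /= subrr normr0 mulr0 sub0r normrN normr1.
  rewrite (_ : `|2%:R - 1| = 1 :> R); last by rewrite ger0_norm; lra.
  have -> : \sum_v err (upd k v e) k ^+ 2 = err (upd k 0 e) k ^+ 2 +
      err (upd k 1 e) k ^+ 2 + err (upd k 2 e) k ^+ 2.
    rewrite !big_ord_recl big_ord0 addr0 addrA.
    by congr (_ ^+ 2 + _ ^+ 2 + _ ^+ 2); congr (err (upd _ _ _) _); apply: val_inj.
  set a := err (upd k 2 e) k; set b := err (upd k 0 e) k; set c := err (upd k 1 e) k.
  rewrite ler_norml => /andP[h1 h2].
  have {}h2 : 2 * s - beta <= 2 * c - a - b by lra.
  have : (2 * s - beta) ^+ 2 <= (2 * c - a - b) ^+ 2.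
    rewrite ler_pXn2r ?nnegrE //; lra.
  have := sqr_ge0 (a - b); have := sqr_ge0 (a + c); have := sqr_ge0 (b + c).
  nra.
have sumk k : #|{: grid}|%:R * (2 * s - beta) ^+ 2 <= 24 * \sum_e err e k ^+ 2.
  have := sum_upd (fun e => err e k ^+ 2) k.
  have : \sum_(e : grid) (2 * s - beta) ^+ 2 <= \sum_e 8 * \sum_v err (upd k v e) k ^+ 2.
    by apply: ler_sum => e _; exact: step.
  rewrite sumr_const -mulr_sumr mulr_natl; lra.
have : N%:R * (#|{: grid}|%:R * (2 * s - beta) ^+ 2) <= #|{: grid}|%:R * (24 * eta ^+ 2).
  have -> : N%:R * (#|{: grid}|%:R * (2 * s - beta) ^+ 2) =
      \sum_(k < N) #|{: grid}|%:R * (2 * s - beta) ^+ 2.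
    by rewrite sumr_const card_ord mulr_natl.
  apply: le_trans (_ : \sum_k 24 * \sum_e err e k ^+ 2 <= _).
    by apply: ler_sum => k _.
  rewrite -mulr_sumr exchange_big mulrCA ler_wpM2l //.
  have -> : #|{: grid}|%:R * eta ^+ 2 = \sum_(e : grid) eta ^+ 2.
    by rewrite sumr_const mulr_natl.
  by apply: ler_sum => e _; exact: happ.
rewrite mulrCA ler_pM2l // ltr0n card_ffun card_ord expn_gt0 //.
Qed.

End Tsarkov.

Lemma normr_grid_val (R : realType) (i : 'I_3) : `|grid_val R i| <= 1.
Proof.
by case: i => [[|[|[|//]]] ?]; rewrite /grid_val /= ler_norml; apply/andP; split; lra.
Qed.

Lemma grid_val2 (R : realType) : grid_val R 2 = 1.
Proof. 
rewrite /grid_val.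
have -> : nat_of_ord (2 : 'I_3) = 2%N by [].
by rewrite mulr2n addrK.
Qed.
Lemma grid_val0 (R : realType) : grid_val R 0 = - 1.
Proof. by rewrite /grid_val /= sub0r. Qed.

(** * Operators *)

Section SufficientlyEuclidean.
Variable R : realType.

Lemma l2norm_sumsq n (u : 'rV[R]_n) : l2norm u = Num.sqrt (sumsq u).
Proof. by rewrite /l2norm sumsqE; congr Num.sqrt; apply: eq_bigr => i _; rewrite ord1. Qed.

Lemma l2norm_ge0 n (u : 'rV[R]_n) : 0 <= l2norm u.
Proof. exact: sqrtr_ge0. Qed.

Lemma sqr_l2norm n (u : 'rV[R]_n) : l2norm u ^+ 2 = sumsq u.
Proof. by rewrite l2norm_sumsq sqr_sqrtr // sumsq_ge0. Qed.

Lemma l2norm_eq0 n (u : 'rV[R]_n) : l2norm u = 0 -> u = 0.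
Proof. by move=> u0; apply: sumsq_eq0; rewrite -sqr_l2norm u0 expr0n. Qed.

Lemma l2normZ n a (u : 'rV[R]_n) : l2norm (a *: u) = `|a| * l2norm u.
Proof. by rewrite !l2norm_sumsq sumsqZ sqrtrM ?sqr_ge0 // sqrtr_sqr. Qed.

Lemma opnorm_wrt_le (V : lmodType R) (W : Type) (nV : V -> R) (nW : W -> R) (T : V -> W) c v :
  (opnorm_wrt nV nW T <= c%:E)%E -> 0 <= nV v -> (nV v = 0 -> nW (T v) = 0) ->
  (forall a, nV (a *: v) = `|a| * nV v) -> (forall a, nW (T (a *: v)) = `|a| * nW (T v)) ->
  nW (T v) <= c * nV v.
Proof.
move=> Tc; rewrite le_eqVlt => /predU1P[v0 /(_ (esym v0)) -> _ _|v0 _ vZ TZ].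
  by rewrite -v0 mulr0.
rewrite -ler_pdivrMr // mulrC.
have : ((nW (T ((nV v)^-1 *: v)))%:E <= c%:E)%E.
  apply: le_trans Tc; apply: ereal_sup_ubound; exists ((nV v)^-1 *: v) => //=.
  by rewrite vZ ger0_norm ?invr_ge0 ?(ltW v0) // mulVf // gt_eqF.
by rewrite lee_fin TZ ger0_norm // invr_ge0 ltW.
Qed.

Lemma opnorm_le (V W : normedModType R) (T : {linear V -> W}) (T' : V -> W) c v :
  T' =1 T -> (opnorm T' <= c%:E)%E -> `|T v| <= c * `|v|.
Proof.
move=> TE; have -> : T' = T by apply/funext.
move=> /opnorm_wrt_le h; apply: h => //.
- by move=> v0; rewrite (normr0_eq0 v0) linear0 normr0.
- by move=> a; rewrite normrZ.
- by move=> a; rewrite linearZ normrZ.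
Qed.

Lemma opnorm_le_of (V W : normedModType R) (T : V -> W) c : 0 <= c ->
  (forall v, `|T v| <= c * `|v|) -> (opnorm T <= c%:E)%E.
Proof.
move=> c0 Tc; apply: ge_ereal_sup => _ [v /= v1 <-]; rewrite lee_fin.
by apply: le_trans (Tc v) _; rewrite -[leRHS]mulr1 ler_wpM2l.
Qed.

(** Rescaling by the norm t of [T n] moves the product of the two norms onto the left inverse. For n
    > 0 a unit vector makes both norms positive, so their bounded product excludes the value [+oo]
    for either. *)
Lemma euclidean_factorization (Y : normedModType R) : sufficiently_euclidean Y ->
  exists2 C : R, 0 < C & forall n, (0 < n)%N -> exists (T : 'rV[R]_n -> Y) (S : Y -> 'rV[R]_n),
    [/\ linear T, linear S, forall u, `|T u| <= l2norm u, forall y, l2norm (S y) <= C * `|y| &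
        cancel T S].
Proof.
move=> [C [Yn [T [P [Rn [C0 H]]]]]]; exists C => // -[//|n] _.
have [_ [Tto Tinj _] [_ [_ Pid]] TR norms] := H n.+1.
have {}Tinj : injective (T n.+1) by move=> u v; apply: Tinj; rewrite inE.
have RT : cancel (T n.+1) (Rn n.+1).
  by move=> u; apply: Tinj; rewrite TR Pid //; exact: Tto.
(* [Rn] is given as a bare function; its linearity comes from the injectivity of [T n]. *)
have Rlin : linear (Rn n.+1).
  by move=> a x y; apply: Tinj; rewrite linearP !TR linearP.
have RZ a y : Rn n.+1 (a *: y) = a *: Rn n.+1 y.
  have R0 : Rn n.+1 0 = 0 by rewrite -[0](linear0 (T n.+1)) RT.
  by have := Rlin a y 0; rewrite R0 !addr0.
pose u : 'rV[R]_n.+1 := delta_mx 0 0.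
have u1 : l2norm u = 1.
  rewrite l2norm_sumsq sumsqE (bigD1 0) //= mxE !eqxx expr1n big1 ?addr0 ?sqrtr1 // => j j0.
  by rewrite mxE (negbTE j0) andbF expr0n.
have u0 : u != 0 by apply/eqP => u0; have := u1; rewrite u0 -(scale0r u) l2normZ normr0 mul0r; lra.
have Tu0 : 0 < `|T n.+1 u| by rewrite normr_gt0 -(linear0 (T n.+1)) (inj_eq Tinj).
set oR := opnorm_wrt _ _ (Rn n.+1) in norms; set oT := opnorm_wrt _ _ (T n.+1) in norms.
have oT0 : (0 < oT)%E.
  apply: (@lt_le_trans _ _ (`|T n.+1 u|)%:E); first by rewrite lte_fin.
  by apply: ereal_sup_ubound; exists u => //=; rewrite u1.
have oR0 : (0 < oR)%E.
  apply: (@lt_le_trans _ _ (`|T n.+1 u|^-1)%:E); first by rewrite lte_fin invr_gt0.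
  apply: ereal_sup_ubound; exists (`|T n.+1 u|^-1 *: T n.+1 u) => /=.
    by rewrite normrZ ger0_norm ?invr_ge0 // mulVf ?gt_eqF.
  by rewrite RZ RT l2normZ u1 mulr1 ger0_norm ?invr_ge0.
have [t tE] : exists t, oT = t%:E.
  case: oT oT0 norms => [t|/=|] // _; first by exists t.
  by rewrite gt0_muley.
have [r rE] : exists r, oR = r%:E.
  case: oR oR0 norms => [r|/=|] // _; first by exists r.
  by rewrite tE gt0_mulye // -tE.
have t0 : 0 < t by rewrite -lte_fin -tE.
have rt : r * t <= C by rewrite -lee_fin EFinM -rE -tE.
have Tle v : `|T n.+1 v| <= t * l2norm v.
  apply: (@opnorm_wrt_le _ _ _ _ _ _ v); first by rewrite -tE; exact: lexx.
  - exact: l2norm_ge0.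
  - by move=> /l2norm_eq0 ->; rewrite linear0 normr0.
  - by move=> a; rewrite l2normZ.
  - by move=> a; rewrite linearZ normrZ.
have Rle y : l2norm (Rn n.+1 y) <= r * `|y|.
  apply: (@opnorm_wrt_le _ _ _ _ _ _ y); first by rewrite -rE; exact: lexx.
  - exact: normr_ge0.
  - move=> /normr0_eq0 ->; rewrite -(scale0r 0) RZ l2normZ normr0 mul0r //.
  - by move=> a; rewrite normrZ.
  - by move=> a; rewrite RZ l2normZ.
exists (fun v => t^-1 *: T n.+1 v), (fun y => t *: Rn n.+1 y); split.
- by move=> a v w; rewrite linearP scalerDr !scalerA mulrC.
- by move=> a x y; rewrite Rlin scalerDr !scalerA mulrC.
- by move=> v; rewrite normrZ ger0_norm ?invr_ge0 ?(ltW t0) // ler_pdivrMl.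
- move=> y; rewrite l2normZ ger0_norm ?(ltW t0) //.
  apply: le_trans (_ : t * (r * `|y|) <= _); first by rewrite ler_wpM2l // ltW.
  by rewrite mulrA (mulrC t) ler_wpM2r.
- by move=> v; rewrite RZ RT scalerA mulfV ?scale1r // gt_eqF.
Qed.

End SufficientlyEuclidean.

(** * The mean value inequality *)

Section MeanValue.
Variables (R : realType).

Lemma lipschitz_linear_continuous (V W : normedModType R) (f : {linear V -> W}) (c : R) :
  (forall v, `|f v| <= c * `|v|) -> continuous f.
Proof.
move=> fc; apply: bounded_linear_continuous.
rewrite /bounded_near; near=> M; near=> x => /=.
apply: le_trans (fc x) _.
apply: le_trans (ler_norm _) _; rewrite normrM normr_id.
have x1 : `|x| <= 1 by near: x; apply: nbhs0_le; exact: ltr01.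
apply: (@le_trans _ _ (`|c| * 1)); first by rewrite ler_wpM2l.
by rewrite mulr1; near: M; apply: nbhs_pinfty_ge; exact: num_real.
Unshelve. all: by end_near. Qed.

(** A norming functional of the vector to be estimated reduces the claim to the scalar mean value
    theorem along the segment. *)
Lemma mean_value_le (X Y : normedModType R) (g : X -> Y) (z h : X) (c : Y) (B : R) :
  (forall t : R, 0 <= t <= 1 -> differentiable g (z + t *: h)) ->
  (forall t : R, 0 <= t <= 1 -> `|'d g (z + t *: h) h - c| <= B) ->
  `|g (z + h) - g z - c| <= B.
Proof.
move=> gd gB; set w := _ - c.
have [xi xiw xile] := norming_functional w.
pose xi' : {linear Y -> R^o} := xi.
have xic : continuous xi'.
  by apply: (@lipschitz_linear_continuous _ _ xi' 1) => v; rewrite mul1r.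
pose p (t : R) : X := z + t *: h.
have pd t : is_diff (t : R^o) p (fun s => s *: h).
  rewrite /p -[X in is_diff _ _ X]add0r; exact: is_diffD.
have gp t : 0 <= t <= 1 -> is_derive (t : R^o) 1 (fun s => xi' (g (p s)) - s * xi c)
    (xi ('d g (p t) h) - xi c).
  move=> t01; have gt := gd t t01.
  have d1 : differentiable (xi' \o (g \o p)) (t : R^o).
    apply: differentiable_comp; last exact: linear_differentiable.
    by apply: differentiable_comp.
  have e1 : 'D_1 (xi' \o (g \o p)) (t : R^o) = xi ('d g (p t) h).
    rewrite deriveE // diff_comp //; last 2 first.
    - by apply: differentiable_comp.
    - exact: linear_differentiable.
    by rewrite diff_lin //= diff_comp //= diff_val scale1r.
  have -> : (fun s => xi' (g (p s)) - s * xi c) = (xi' \o (g \o p)) \- (fun s => s * xi c).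
    by [].
  apply: is_deriveB; first by apply: DeriveDef => //; exact/diff_derivable.
  have dc : is_diff (t : R^o) ( *:%R^~ (xi c : R^o)) ( *:%R^~ (xi c : R^o)) by exact: is_diff_scalel.
  have [dc1 dc2] := dc.
  by apply: DeriveDef; [exact/diff_derivable | rewrite deriveE // dc2 scale1r].
have [||t t01 E] := @MVT_segment R (fun s => xi' (g (p s)) - s * xi c)
    (fun t => xi ('d g (p t) h) - xi c) 0 1 ler01.
- by move=> t /andP[]; rewrite !bnd_simp => t0 t1; apply: gp; rewrite !ltW.
- apply: derivable_within_continuous => t; rewrite in_itv /= => t01.
  by have [] := gp t t01.
move: E; rewrite subr0 mulr1 mul1r mul0r subr0 /p scale1r scale0r addr0.
move=> E; have -> : `|w| = xi ('d g (z + t *: h) h - c).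
  apply: etrans (etrans _ E) _; last by rewrite linearB.
  rewrite -xiw /w !linearB /=; exact: addrAC.
apply: le_trans (ler_norm _) _; apply: le_trans (xile _) _; apply: gB.
by move: t01; rewrite in_itv.
Qed.

End MeanValue.

Lemma factor_through (I X Z : Type) (D : set I) (p : I -> X) (F : I -> Z) (z0 : Z) :
  (forall i j, D i -> D j -> p i = p j -> F i = F j) ->
  exists f : X -> Z, forall i, D i -> f (p i) = F i.
Proof.
move=> pF.
have H (x : X) : exists z, forall i, D i -> p i = x -> F i = z.
  have [[i Di pi]|none] := pselect (exists2 i, D i & p i = x).
    by exists (F i) => j Dj pj; apply: pF => //; rewrite pi pj.
  by exists z0 => i Di pi; exfalso; apply: none; exists i.
have [f fE] := choice H.
by exists f => i Di; rewrite (fE (p i) i).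
Qed.

Lemma modulus_small (R : realType) (omega : R -> \bar R) (d : R) : modulus omega -> 0 < d ->
  exists2 r : R, 0 < r & forall u, 0 <= u -> u < r -> (omega u <= d%:E)%E.
Proof.
move=> [_ _ + omega0] d0; rewrite omega0 => cv.
have nd : nbhs (0%E : \bar R) [set x | (x <= d%:E)%E].
  have : nbhs (0%E : \bar R) [set x : \bar R | (x < d%:E)%E].
    by apply: open_nbhs_nbhs; split; [exact: open_ereal_lt_ereal | rewrite /= lte_fin].
  by apply: filterS => x /ltW.
have := cv _ nd; rewrite /nbhs /= => -[r r0 rw].
exists r => // u u0 ur; apply: rw => //=.
by rewrite /ball_ /= sub0r normrN ger0_norm.
Qed.

Lemma maximal_separated (R : realType) (X : normedModType R) (I : finType) (x : I -> X) (t : R) :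
  0 < t -> exists D : {set I},
    (forall i j, i \in D -> j \in D -> x i <> x j -> t <= `|x i - x j|) /\
    forall i, exists2 j, j \in D & `|x i - x j| < t.
Proof.
move=> t0.
(* [x] need not be injective, so distinct indices with the same value are allowed. *)
pose P (D : {set I}) := [forall i in D, forall j in D, (x i == x j) || (t <= `|x i - x j|)].
have [D /maxsetP[PD Dmax]] : {D | maxset P D}.
  apply: ex_maxset; exists finset.set0.
  by apply/forall_inP => i; rewrite inE.
exists D; split.
  move=> i j iD jD /eqP ij; move/forall_inP/(_ i iD)/forall_inP/(_ j jD): PD.
  by rewrite (negbTE ij).
move=> i; apply: contrapT => none.
have far j : j \in D -> t <= `|x i - x j|.
  by move=> jD; rewrite leNgt; apply/negP => lt; apply: none; exists j.
have E : (i |: D)%SET = D.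
  apply: Dmax; last exact: finset.subsetUr.
  apply/forall_inP => j; rewrite !inE => /predU1P[->|jD]; apply/forall_inP => k; rewrite !inE.
    by move=> /predU1P[->|kD]; rewrite ?eqxx // far ?orbT.
  move=> /predU1P[->|kD]; first by rewrite distrC far ?orbT.
  by move/forall_inP/(_ j jD)/forall_inP/(_ k kD): PD.
have : i \in D by rewrite -E !inE eqxx.
by move=> /far; rewrite subrr normr0 leNgt t0.
Qed.

(** * One piece of the counterexample *)

Section Obstruction.
Variables (R : realType) (X Y : normedModType R) (e0 : X) (tau : {scalar X}).
Hypothesis e0_norm : `|e0| = 1.

(* S lies at height lam along e0 and S' at height lam + t. *)
Definition nonextendable (omega : R -> \bar R) (lam K t : R) (S S' : set X) (Phi : X -> Y) : Prop :=
  forall g : X -> Y,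
    (forall z, `|z| <= 3 * lam -> differentiable g z) ->
    (forall z z', `|z| <= 3 * lam -> `|z'| <= 3 * lam ->
      (opnorm ('d g z \- 'd g z')%R <= K%:E * omega `|z - z'|%R)%E) ->
    (forall x, S x -> g (lam *: e0 + x) = 0) ->
    (forall x, S' x -> g (lam *: e0 + x + t *: e0) = t *: Phi x) -> False.

(** The conditions behind (W_{1,1}): separation of [S'] controls two upper points of one piece,
    while the bounds by [lam] control points of different pieces, whose distance is comparable to
    their scales. *)
Definition admissible_piece (lam t : R) (S S' : set X) (Phi : X -> Y) : Prop :=
  [/\ 0 <= t <= lam /\ finite_set S,
      forall x, S x -> [/\ tau x = 0, `|x| <= lam & `|Phi x| <= lam],
      forall x x', S x -> S x' -> `|Phi x' - Phi x| <= `|x' - x|,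
      S' `<=` S &
      forall x x', S' x -> S' x' -> x <> x' -> t <= `|x' - x|].

Lemma diff_close (omega : R -> \bar R) (K d lam : R) (g : X -> Y) : 0 <= K -> 0 <= d ->
  (forall z z', `|z| <= lam -> `|z'| <= lam ->
    (opnorm ('d g z \- 'd g z')%R <= K%:E * omega `|z - z'|%R)%E) ->
  forall z z' v, `|z| <= lam -> `|z'| <= lam -> (omega `|z - z'|%R <= d%:E)%E ->
    `|'d g z v - 'd g z' v| <= K * d * `|v|.
Proof.
move=> K0 d0 gom z z' v zl zl' om.
have := @opnorm_le _ _ _ ('d g z \- 'd g z') _ (K * d) v (fun=> erefl).
apply; apply: le_trans (gom _ _ zl zl') _.
by rewrite EFinM lee_wpmul2l // lee_fin.
Qed.

Lemma segment_norm_le (z h : X) (t r : R) : 0 <= t <= 1 -> `|z| <= r -> `|z + h| <= r ->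
  `|z + t *: h| <= r.
Proof.
move=> /andP[t0 t1] zr zhr.
have -> : z + t *: h = (1 - t) *: z + t *: (z + h).
  by rewrite scalerDr addrA -scalerDl subrK scale1r.
apply: le_trans (ler_normD _ _) _; rewrite !normrZ !ger0_norm ?subr_ge0 //.
have -> : r = (1 - t) * r + t * r by ring.
by rewrite lerD // ler_wpM2l // subr_ge0.
Qed.

(** The choices come in the order rho, d1, t, d2, N: closeness of g / t to Phi fixes t, then the
    second differences of g / t fix d2 and N. The contradiction is rho^2 = N s^2 <= 24 (rho /
    10)^2. *)
Lemma piece_exists (omega : R -> \bar R) (C lam K : R) :
  modulus omega -> 0 < C -> 0 < lam -> 0 < K ->
  (forall N, (0 < N)%N -> exists y : 'I_N -> X,
    [/\ forall k, tau (y k) = 0, forall k, `|y k| <= 6,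
        forall d : 'I_N -> R, (forall k, small_int 1 (d k)) ->
          `|\sum_k d k *: y k| <= 12 * Num.sqrt N%:R &
        forall d : 'I_N -> R, (forall k, small_int 2 (d k)) ->
          \sum_k d k ^+ 2 <= `|\sum_k d k *: y k| ^+ 2]) ->
  (forall n, (0 < n)%N -> exists (T : 'rV[R]_n -> Y) (S : Y -> 'rV[R]_n),
    [/\ linear T, linear S, forall u, `|T u| <= l2norm u, forall y, l2norm (S y) <= C * `|y| &
        cancel T S]) ->
  exists (t : R) (S S' : set X) (Phi : X -> Y),
    admissible_piece lam t S S' Phi /\ nonextendable omega lam K t S S' Phi.
Proof.
move=> om C0 lam0 K0 cubes factor.
(* 12 is the constant of the cube vectors: the grid points have norm at most 12 s sqrt N = 12
   rho. *)
pose rho := lam / 12; have rho0 : 0 < rho by rewrite divr_gt0.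
(* Makes C (3 K d1) equal to rho / 20; the choice of t makes C t at most the same. *)
pose d1 := rho / (60 * C * K); have d10 : 0 < d1 by rewrite divr_gt0 // !mulr_gt0.
have [r1 r10 om1] := modulus_small om d10.
pose t := Num.min lam (Num.min (r1 / 2) (rho / (20 * C))).
have t0 : 0 < t by rewrite !lt_min lam0 !divr_gt0 // !mulr_gt0.
have tlam : t <= lam by rewrite ge_min lexx.
have tr1 : t < r1.
  by apply: (@le_lt_trans _ _ (r1 / 2)); [rewrite !ge_min lexx orbT | lra].
have trho : t <= rho / (20 * C) by rewrite !ge_min lexx !orbT.
(* Makes the bound C t^-1 (12 s) (K d2) on the second differences equal to s. *)
pose d2 := t / (12 * C * K); have d20 : 0 < d2 by rewrite divr_gt0 // !mulr_gt0.
have [r2 r20 om2] := modulus_small om d20.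
have [n hn] : exists n : nat, 6 * rho / r2 < Num.sqrt n.+1%:R.
  exists (Num.truncn ((6 * rho / r2) ^+ 2)).
  have h0 : 0 <= 6 * rho / r2 by rewrite !mulr_ge0 ?invr_ge0 // ltW.
  rewrite -(@ltr_pXn2r _ 2) ?nnegrE ?sqrtr_ge0 // sqr_sqrtr //.
  by rewrite truncnS_gt // sqr_ge0.
pose N := n.+1; pose s := rho / Num.sqrt N%:R.
have sN0 : 0 < Num.sqrt N%:R :> R by rewrite sqrtr_gt0 ltr0n.
have s0 : 0 < s by rewrite divr_gt0.
have sr2 : 6 * s < r2.
  by move: hn; rewrite ltr_pdivrMr // [_ * r2]mulrC -ltr_pdivrMr // /s mulrA.
have s2N : s ^+ 2 * N%:R = rho ^+ 2.
  by rewrite /s exprMn exprVn sqr_sqrtr // mulfVK // pnatr_eq0.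
have [y [ytau y6 y1 y2]] := cubes N isT.
have [T [S [Tlin Slin Tle Sle TS]]] := factor N isT.
pose gv := @grid_val R.
pose x (e : {ffun 'I_N -> 'I_3}) : X := s *: \sum_k gv (e k) *: y k.
pose a (e : {ffun 'I_N -> 'I_3}) : 'rV[R]_N := \row_k (s * `|gv (e k)|).
have gv1 i : small_int 1 (gv i) by exists i; [rewrite -ltnS | ].
have gv2 i j : small_int 2 (gv i - gv j).
  exists (i + (2 - j))%N.
    have i2 : (i <= 2)%N by rewrite -ltnS.
    exact: leq_add i2 (leq_subr j 2).
  have j2 : (j <= 2)%N by rewrite -ltnS.
  by rewrite natrD natrB // /gv /grid_val; ring.
have xtau e : tau (x e) = 0.
  rewrite linearZ /= linear_sum big1 ?mulr0 // => k _.
  by rewrite linearZ /= ytau mulr0.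
have xlam e : `|x e| <= lam.
  rewrite normrZ gtr0_norm //.
  have := y1 _ (fun k => gv1 (e k)).
  rewrite -(ler_pM2l s0) => h; apply: le_trans h _.
  have -> : s * (12 * Num.sqrt N%:R) = lam by rewrite /s /rho; field; rewrite gt_eqF.
  exact: lexx.
have TB u v : T u - T v = T (u - v).
  by rewrite (addrC u) -(scaleN1r v) Tlin scaleN1r addrC.
have T0 : T 0 = 0 by rewrite -(subrr 0) -TB subrr.
have Ta e : `|T (a e)| <= rho.
  apply: le_trans (Tle _) _; rewrite -(@ler_pXn2r _ 2) ?nnegrE ?l2norm_ge0 ?(ltW rho0) //.
  rewrite sqr_l2norm sumsqE -s2N.
  have -> : s ^+ 2 * N%:R = \sum_(k < N) s ^+ 2 by rewrite sumr_const card_ord mulr_natr.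
  apply: ler_sum => k _; rewrite mxE exprMn -[leRHS]mulr1 ler_wpM2l ?sqr_ge0 //.
  by rewrite expr_le1 // normr_grid_val.
(* Differences of grid values are integers of modulus at most 2, which the lower estimate for the
   y_k covers; taking absolute values is 1-Lipschitz in each coordinate. *)
have TaL e e' : `|T (a e') - T (a e)| <= `|x e' - x e|.
  rewrite TB; apply: le_trans (Tle _) _.
  rewrite -(@ler_pXn2r _ 2) ?nnegrE ?l2norm_ge0 // sqr_l2norm sumsqE.
  rewrite -scalerBr -sumrB normrZ gtr0_norm // exprMn.
  under [in leRHS]eq_bigr do rewrite -scalerBl.
  apply: le_trans (_ : s ^+ 2 * \sum_k (gv (e' k) - gv (e k)) ^+ 2 <= _); last first.
    by rewrite ler_wpM2l ?sqr_ge0 // y2.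
  rewrite mulr_sumr; apply: ler_sum => k _; rewrite !mxE -mulrBr exprMn ler_wpM2l ?sqr_ge0 //.
  rewrite -[leLHS]real_normK ?num_real // -[leRHS]real_normK ?num_real //.
  by rewrite ler_pXn2r ?nnegrE // ler_dist_dist.
have [Phi PhiE] : exists Phi : X -> Y, forall e, setT e -> Phi (x e) = T (a e).
  apply: (factor_through 0) => e e' _ _ xe; apply/eqP.
  by rewrite -subr_eq0 -normr_le0; apply: le_trans (TaL _ _) _; rewrite xe subrr normr0.
have {}PhiE e : Phi (x e) = T (a e) by exact: PhiE.
have [D [Dsep Dnet]] := maximal_separated x t0.
exists t, (range x), [set x e | e in [set e | e \in D]], Phi; split.
  split.
  - by split; [rewrite ltW | exact: finite_image].
  - move=> _ [e _ <-]; split=> //; rewrite PhiE; apply: le_trans (Ta e) _.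
    by rewrite /rho; lra.
  - by move=> _ _ [e _ <-] [e' _ <-]; rewrite !PhiE.
  - by move=> _ [e _ <-]; exists e.
  - by move=> _ _ [e /= eD <-] [e' /= e'D <-] ne; rewrite distrC; exact: Dsep.
move=> g gdiff gom gS gS'.
have close1 := diff_close (ltW K0) (ltW d10) gom.
have close2 := diff_close (ltW K0) (ltW d20) gom.
pose z0 e := lam *: e0 + x e; pose z1 e := z0 e + t *: e0.
have z0le e : `|z0 e| <= 3 * lam.
  apply: le_trans (ler_normD _ _) _; rewrite normrZ e0_norm gtr0_norm // mulr1.
  by have := xlam e; clear -lam0; lra.
have z1le e : `|z1 e| <= 3 * lam.
  apply: le_trans (ler_normD _ _) _; rewrite [`|t *: _|]normrZ e0_norm [`|t|]gtr0_norm // mulr1.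
  have : `|z0 e| <= 2 * lam; last by clear -tlam; lra.
  apply: le_trans (ler_normD _ _) _; rewrite normrZ e0_norm gtr0_norm // mulr1.
  by have := xlam e; clear -lam0; lra.
have norm_te0 : `|t *: e0| = t by rewrite normrZ e0_norm mulr1 gtr0_norm.
pose psi e := 'd g (z0 e) e0.
have lin1 e : `|g (z1 e) - t *: psi e| <= t * (K * d1).
  have -> : g (z1 e) - t *: psi e = g (z0 e + t *: e0) - g (z0 e) - 'd g (z0 e) (t *: e0).
    by rewrite [g (z0 e)]gS ?subr0 ?linearZ //; exists e.
  apply: mean_value_le => u u01.
    by apply: gdiff; exact: segment_norm_le u01 (z0le e) (z1le e).
  have h : `|z0 e + u *: (t *: e0)| <= 3 * lam by exact: segment_norm_le u01 (z0le e) (z1le e).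
  apply: le_trans (close1 _ _ _ h (z0le e) _) _; last by rewrite norm_te0 mulrC.
  rewrite addrAC subrr add0r normrZ norm_te0; move/andP: u01 => [u0 u1].
  rewrite ger0_norm //; apply: om1; first by rewrite mulr_ge0 // ltW.
  by apply: le_lt_trans tr1; rewrite ler_piMl // ltW.
have phi1 e : e \in D -> `|psi e - T (a e)| <= K * d1.
  move=> eD; rewrite -(ler_pM2l t0); apply: le_trans (lin1 e).
  have -> : g (z1 e) = t *: T (a e).
    by rewrite -PhiE -gS' //; exists e.
  by rewrite distrC -scalerBr normrZ gtr0_norm.
(* The derivative at [z0 e] is compared with that at a net point nearer than t. Linearization, this
   comparison and [phi1] cost K d1 each, and the Lipschitz bound for Phi costs t. *)
have approx e : `|g (z1 e) - t *: T (a e)| <= t * (3 * K * d1 + t).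
  have [e' e'D ee'] := Dnet e.
  have h1 : `|psi e - psi e'| <= K * d1.
    rewrite -[K * d1]mulr1 -[in leRHS]e0_norm; apply: close1 => //.
    by rewrite /z0 opprD addrACA subrr add0r; apply: om1 => //; apply: lt_trans tr1.
  have h2 := phi1 e' e'D.
  have h3 : `|T (a e') - T (a e)| <= t.
    by apply: le_trans (TaL _ _) _; rewrite distrC ltW.
  have -> : g (z1 e) - t *: T (a e) = (g (z1 e) - t *: psi e) +
      t *: ((psi e - psi e') + (psi e' - T (a e')) + (T (a e') - T (a e))).
    by rewrite !subrKA scalerBr subrKA.
  apply: le_trans (ler_normD _ _) _.
  have -> : t * (3 * K * d1 + t) = t * (K * d1) + t * (K * d1 + K * d1 + t) by ring.
  apply: lerD => //; rewrite normrZ gtr0_norm // ler_wpM2l ?(ltW t0) //.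
  apply: le_trans (ler_normD _ _) _; apply: lerD => //.
  by apply: le_trans (ler_normD _ _) _; apply: lerD.
have S0 : S 0 = 0 by rewrite -T0 TS.
have SZ c v : S (c *: v) = c *: S v by have := Slin c v 0; rewrite S0 !addr0.
have SD u v : S (u + v) = S u + S v by have := Slin 1 u v; rewrite !scale1r.
have SB u v : S (u - v) = S u - S v by rewrite SD -scaleN1r SZ scaleN1r.
pose h e k := S (t^-1 *: g (z1 e)) 0 k.
have tV0 : 0 < t^-1 by rewrite invr_gt0.
have := @grid_approximation R N h s (C * (3 * K * d1 + t)) s (ltW s0).
have eta0 : 0 <= 3 * K * d1 + t.
  by rewrite addr_ge0 ?(ltW t0) // -mulrA mulr_ge0 // (mulr_ge0 (ltW K0) (ltW d10)).
have hs : s <= 2 * s by clear -s0; lra.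
move=> /(_ hs) H.
have : N%:R * (2 * s - s) ^+ 2 <= 24 * (C * (3 * K * d1 + t)) ^+ 2.
  apply: H => [e|e k ek].
    have -> : \sum_k (h e k - s * `|grid_val R (e k)|) ^+ 2 =
        l2norm (S (t^-1 *: (g (z1 e) - t *: T (a e)))) ^+ 2.
      rewrite sqr_l2norm sumsqE; apply: eq_bigr => k _; congr (_ ^+ 2).
      by rewrite scalerBr scalerA mulVf ?gt_eqF // scale1r SB TS !mxE.
    rewrite ler_pXn2r ?nnegrE ?l2norm_ge0 ?mulr_ge0 ?(ltW C0) //.
    apply: le_trans (Sle _) _; rewrite ler_wpM2l ?(ltW C0) // normrZ gtr0_norm //.
    by rewrite ler_pdivrMl.
  pose v := s *: y k.
  have vle : `|v| <= 6 * s.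
    by rewrite normrZ gtr0_norm // mulrC ler_wpM2r // ltW.
  (* [e k = 1] is the value 0 in direction k, so [upd k 2] and [upd k 0] are the steps v and - v. *)
  have xupd i : x (upd k i e) = x e + gv i *: v.
    rewrite /x (bigD1 k) //= [in RHS](bigD1 k) //= !ffunE eqxx ek.
    have -> : gv 1 = 0 by rewrite /gv /grid_val subrr.
    rewrite scale0r add0r scalerDr addrC; congr (_ + _); last by rewrite /v !scalerA mulrC.
    by congr (_ *: _); apply: eq_bigr => j jk; rewrite ffunE (negbTE jk).
  have z1upd i : z1 (upd k i e) = z1 e + gv i *: v.
    by rewrite /z1 /z0 xupd addrA [LHS]addrAC.
  have gvE2 : gv 2 = 1 by exact: grid_val2.
  have gvE0 : gv 0 = - 1 by exact: grid_val0.
  have second w : `|w| <= 6 * s -> `|z1 e + w| <= 3 * lam ->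
      `|g (z1 e + w) - g (z1 e) - 'd g (z1 e) w| <= K * d2 * (6 * s).
    move=> w6 w3; apply: mean_value_le => u u01.
      by apply: gdiff; exact: segment_norm_le u01 (z1le e) w3.
    have hh : `|z1 e + u *: w| <= 3 * lam by exact: segment_norm_le u01 (z1le e) w3.
    apply: le_trans (close2 _ _ _ hh (z1le e) _) _; last first.
      by rewrite ler_wpM2l // mulr_ge0 // ltW.
    rewrite addrAC subrr add0r normrZ; move/andP: u01 => [u0 u1].
    rewrite ger0_norm //; apply: om2; first by rewrite mulr_ge0.
    by apply: le_lt_trans sr2; apply: le_trans w6; rewrite ler_piMl.
  have Dsec : `|g (z1 (upd k 2 e)) + g (z1 (upd k 0 e)) - 2 *: g (z1 e)| <= 12 * s * (K * d2).
    have e2 : z1 e + v = z1 (upd k 2 e) by rewrite z1upd gvE2 scale1r.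
    have e0' : z1 e + - v = z1 (upd k 0 e) by rewrite z1upd gvE0 scaleN1r.
    have h2 := second v vle; rewrite e2 in h2.
    have vle' : `|- v| <= 6 * s by rewrite normrN.
    have h0 := second (- v) vle'; rewrite e0' in h0.
    have -> : g (z1 (upd k 2 e)) + g (z1 (upd k 0 e)) - 2 *: g (z1 e) =
        (g (z1 (upd k 2 e)) - g (z1 e) - 'd g (z1 e) v) +
        (g (z1 (upd k 0 e)) - g (z1 e) - 'd g (z1 e) (- v)).
      rewrite linearN opprK scaler_nat mulr2n opprD.
      by rewrite [in RHS]addrACA addNr addr0 addrACA.
    apply: le_trans (ler_normD _ _) _.
    have -> : 12 * s * (K * d2) = K * d2 * (6 * s) + K * d2 * (6 * s) by ring.
    by apply: lerD; [apply: h2 | apply: h0]; exact: z1le.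
  have -> : h (upd k 2 e) k + h (upd k 0 e) k - 2 * h e k =
      S (t^-1 *: (g (z1 (upd k 2 e)) + g (z1 (upd k 0 e)) - 2 *: g (z1 e))) 0 k.
    rewrite /h !SZ SB SD SZ !mxE; ring.
  apply: le_trans (le_sqrt_sumsq _ _) _; rewrite -l2norm_sumsq.
  apply: le_trans (Sle _) _; rewrite normrZ gtr0_norm //.
  apply: (@le_trans _ _ (C * (t^-1 * (12 * s * (K * d2))))).
    by rewrite ler_wpM2l ?(ltW C0) // ler_wpM2l // ltW.
  have -> : C * (t^-1 * (12 * s * (K * d2))) = s; last exact: lexx.
  by rewrite /d2; field; rewrite !gt_eqF.
have -> : N%:R * (2 * s - s) ^+ 2 = rho ^+ 2 by rewrite -s2N; ring.
have b1 : C * (3 * K * d1 + t) <= rho / 10.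
  have : C * t <= rho / 20.
    have C20 : 0 < 20 * C by rewrite mulr_gt0.
    move: trho; rewrite (ler_pdivlMr _ _ C20); clear; lra.
  have : C * (3 * K * d1) = rho / 20 by rewrite /d1; field; rewrite !gt_eqF.
  clear; lra.
have b2 : (C * (3 * K * d1 + t)) ^+ 2 <= (rho / 10) ^+ 2.
  have rho10 : 0 <= rho / 10 by rewrite divr_ge0 // ltW.
  by rewrite ler_pXn2r ?nnegrE // (mulr_ge0 (ltW C0) eta0).
have b3 : 0 < rho ^+ 2 by rewrite exprn_gt0.
apply/negP; rewrite -ltNge; apply: le_lt_trans (_ : 24 * (rho / 10) ^+ 2 < _).
  by rewrite ler_wpM2l.
by rewrite exprMn mulrCA gtr_pMr //; lra.
Qed.

End Obstruction.

(** * Gluing the pieces *)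

Section Assembly.
Variables (R : realType) (X Y : normedModType R) (e0 : X) (tau : {scalar X}).
Hypotheses (e0_norm : `|e0| = 1) (tau_e0 : tau e0 = 1) (tau_le : forall x, `|tau x| <= `|x|).
Variables (lam t : nat -> R) (S S' : nat -> set X) (Phi : nat -> X -> Y).
Hypothesis lam_ge0 : forall n, 0 <= lam n.
Hypothesis lam_gap : forall m n, m <> n -> 4 * lam m <= lam n \/ 4 * lam n <= lam m.
Hypothesis pieces : forall n, admissible_piece tau (lam n) (t n) (S n) (S' n) (Phi n).

(* An index (n, x, b) denotes the point of piece n over x, at the upper level if b. *)
Definition valid (i : nat * X * bool) : Prop :=
  S i.1.1 i.1.2 /\ (i.2 -> S' i.1.1 i.1.2).

Definition height (i : nat * X * bool) : R := lam i.1.1 + i.2%:R * t i.1.1.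

Definition point (i : nat * X * bool) : X := height i *: e0 + i.1.2.

Definition value (i : nat * X * bool) : Y := (i.2%:R * t i.1.1) *: Phi i.1.1 i.1.2.

Definition slope (i : nat * X * bool) : Y := Phi i.1.1 i.1.2.

Lemma tau_point i : valid i -> tau (point i) = height i.
Proof.
case: i => [[n x] b] [/= Sx _]; have [_ /(_ _ Sx)[tx _ _] _ _ _] := pieces n.
by rewrite linearD linearZ /= tau_e0 mulr1 tx addr0.
Qed.

Lemma norm_slope i : valid i -> `|slope i| <= lam i.1.1.
Proof. by case: i => [[n x] b] [/= Sx _]; have [_ /(_ _ Sx)[] ] := pieces n. Qed.

Lemma norm_value i : valid i -> `|value i| <= lam i.1.1 ^+ 2.
Proof.
move=> vi; rewrite normrZ expr2; apply: ler_pM => //; last exact: norm_slope.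
have [[/andP[t0 tl] _] _ _ _ _] := pieces i.1.1.
by rewrite ger0_norm ?mulr_ge0 //; case: (i.2); rewrite ?mul1r ?mul0r.
Qed.

Lemma height_bounds i : lam i.1.1 <= height i <= 2 * lam i.1.1.
Proof.
have [[/andP[t0 tl] _] _ _ _ _] := pieces i.1.1.
by rewrite /height; case: (i.2); rewrite ?mul1r ?mul0r; apply/andP; split; lra.
Qed.

Lemma norm_point i : valid i -> `|point i| <= 3 * lam i.1.1.
Proof.
case: i => [[n x] b] vi; have [Sx _] := vi; rewrite /= in Sx *.
have [_ /(_ _ Sx)[_ xl _] _ _ _] := pieces n.
have /= /andP[h1 h2] := height_bounds (n, x, b).
apply: le_trans (ler_normD _ _) _; rewrite normrZ e0_norm mulr1 ger0_norm /=.
  lra.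
exact: le_trans h1.
Qed.

(** Heights of piece n lie in [lam n, 2 lam n], so a ratio of at least 4 between scales leaves a gap
    of at least half the larger one, and [tau] detects it. *)
Lemma distinct_pieces i j : valid i -> valid j -> i.1.1 <> j.1.1 ->
  lam i.1.1 <= 2 * `|point j - point i| /\ lam j.1.1 <= 2 * `|point j - point i|.
Proof.
move=> vi vj ij.
have := tau_le (point j - point i); rewrite linearB /= !tau_point // => h.
have /andP[i1 i2] := height_bounds i; have /andP[j1 j2] := height_bounds j.
have li := lam_ge0 i.1.1; have lj := lam_ge0 j.1.1.
have n1 := ler_norm (height j - height i).
have n2 := ler_norm (height i - height j); rewrite distrC in n2.
by case: (lam_gap ij) => gap; split; lra.
Qed.

(** Since [tau d] is the difference of heights, the remainder is b' t (Phi x' - Phi x). It vanishes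
    if the second point is low; otherwise t <= |d| when the levels differ, and t <= 2 |d| by
    separation when both points are high and distinct. *)
Lemma same_piece_estimates n x b x' b' d : valid (n, x, b) -> valid (n, x', b') ->
  d = point (n, x', b') - point (n, x, b) ->
  `|value (n, x', b') - value (n, x, b) - tau d *: slope (n, x, b)| <= 10 * `|d| ^+ 2 /\
  `|slope (n, x', b') - slope (n, x, b)| <= 4 * `|d|.
Proof.
move=> vi vj dpq; have td := tau_le d.
have d0 : 0 <= `|d| := normr_ge0 d.
have [Sx Nx] := vi; have [Sx' Nx'] := vj; rewrite /= in Sx Nx Sx' Nx'.
have [[/andP[t0 _] _] bounds PhiL _ sep] := pieces n.
have tauE : tau d = (b'%:R - b%:R) * t n.
  by rewrite dpq linearB /= !tau_point // /height /=; ring.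
have dE : x' - x = d - tau d *: e0.
  have -> : tau d = height (n, x', b') - height (n, x, b).
    by rewrite tauE /height /=; ring.
  by rewrite dpq /point opprD addrACA -scalerBl [RHS]addrC addKr.
have xd : `|x' - x| <= 2 * `|d|.
  by rewrite dE; apply: le_trans (ler_normB _ _) _; rewrite normrZ e0_norm; lra.
have Ld := PhiL _ _ Sx Sx'.
rewrite /slope /value /=; split; last by apply: le_trans Ld _; lra.
have -> : (b'%:R * t n) *: Phi n x' - (b%:R * t n) *: Phi n x - tau d *: Phi n x =
    (b'%:R * t n) *: (Phi n x' - Phi n x).
  rewrite tauE scalerBr -addrA -opprD -scalerDl; congr (_ - _ *: _); ring.
rewrite normrZ; have dd0 : 0 <= 10 * `|d| ^+ 2 by rewrite mulr_ge0 // exprn_ge0.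
clear dpq vi vj; case: b' Nx' tauE => Nx' tauE; last by rewrite mul0r normr0 mul0r.
rewrite mul1r ger0_norm //.
case: b Nx tauE => Nx tauE; last first.
  have td' : t n <= `|d| by apply: le_trans td; rewrite tauE subr0 mul1r ler_norm.
  apply: (@le_trans _ _ (`|d| * (2 * `|d|))); last by rewrite expr2; nra.
  by apply: ler_pM => //; apply: le_trans xd.
have [->|xx] := eqVneq x x'; first by rewrite subrr normr0 mulr0.
have tx2 : t n <= 2 * `|d|.
  by apply: le_trans xd; apply: sep; [exact: Nx | exact: Nx' | exact/eqP].
apply: (@le_trans _ _ (2 * `|d| * (2 * `|d|))); last by rewrite expr2; nra.
by apply: ler_pM => //; apply: le_trans xd.
Qed.

Lemma piece_estimates i j d : valid i -> valid j -> d = point j - point i ->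
  `|value j - value i - tau d *: slope i| <= 10 * `|d| ^+ 2 /\
  `|slope j - slope i| <= 4 * `|d|.
Proof.
move=> vi vj dE.
have [ij|ij] := pselect (i.1.1 = j.1.1).
  move: i j vi vj ij dE => [[n x] b] [[m x'] b'] vi vj /= nm; subst m.
  exact: same_piece_estimates.
have td := tau_le d; have d0 : 0 <= `|d| := normr_ge0 d.
have [li lj] := distinct_pieces vi vj ij; rewrite -dE in li lj.
have := norm_value vi; have := norm_value vj.
have := norm_slope vi; have := norm_slope vj => sj si fj fi; split.
  apply: le_trans (ler_normB _ _) _; rewrite normrZ.
  have := ler_normB (value j) (value i).
  have : `|tau d| * `|slope i| <= `|d| * (2 * `|d|).
    by apply: ler_pM => //; apply: le_trans si li.
  have : lam i.1.1 ^+ 2 <= (2 * `|d|) ^+ 2.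
    by rewrite ler_pXn2r ?nnegrE ?mulr_ge0.
  have : lam j.1.1 ^+ 2 <= (2 * `|d|) ^+ 2.
    by rewrite ler_pXn2r ?nnegrE ?mulr_ge0.
  rewrite !exprMn !expr2; move: fi fj; rewrite !expr2; lra.
by apply: le_trans (ler_normB _ _) _; lra.
Qed.

Definition point_set : set X := point @` [set i | valid i].

Lemma low_points_finite m : finite_set (point @` [set i | valid i /\ (i.1.1 < m)%N]).
Proof.
apply: (@sub_finite_set _ _ (\bigcup_(n in `I_m) point @`
    ((fun q : X * bool => (n, q.1, q.2)) @` (S n `*` [set: bool])))).
  move=> _ [[[n x] b] [[/= Sx _] nm] <-]; exists n => //.
  by exists (n, x, b) => //; exists (x, b).
apply: bigcup_finite; first exact: finite_II.
move=> n _; do 2 apply: finite_image; apply: finite_setX => //.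
by have [[_ fS] _ _ _ _] := pieces n.
Qed.

(** The set is the intersection over r of the unions of finitely many low-index points and a closed
    ball of radius r: a nonzero z avoids the ball of radius |z| / 2, hence is one of the points. *)
Lemma point_set_closed : (forall r : R, 0 < r -> exists m, forall n, (m <= n)%N -> 3 * lam n < r) ->
  point_set 0 -> closed point_set.
Proof.
move=> lam_small A0; have [m mE] := choice (fun r : {posnum R} => lam_small _ (gt0 r)).
pose C (r : {posnum R}) := point @` [set i | valid i /\ (i.1.1 < m r)%N] `|`
  closed_ball_ Num.norm (0 : X) r%:num.
have -> : point_set = \bigcap_(r in [set: {posnum R}]) C r.
  apply/seteqP; split=> [_ [i vi <-] r _|z Cz].
    have [im|mi] := ltnP i.1.1 (m r); first by left; exists i.
    right; rewrite /closed_ball_ /= sub0r normrN.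
    by apply: le_trans (norm_point vi) _; apply: ltW; exact: mE.
  have [->//|z0] := eqVneq z 0; have zn : 0 < `|z| / 2 by rewrite divr_gt0 // normr_gt0.
  have [[i [vi _] <-]|] := Cz (PosNum zn) I; first by exists i.
  rewrite /closed_ball_ /= sub0r normrN => zz.
  by move: zn; rewrite ltNge; move: zz; lra.
apply: closed_bigI => r _; apply: closedU.
  have acc : accessible_space X by apply: hausdorff_accessible; exact: norm_hausdorff.
  by move/accessible_finite_set_closed: acc; apply; exact: low_points_finite.
exact: closed_closed_ball_.
Qed.

Lemma point_set_bounded : (forall n, lam n <= 1) -> forall z, point_set z -> `|z| <= 3.
Proof.
move=> lam1 _ [i vi <-]; apply: le_trans (norm_point vi) _.
by have := lam1 i.1.1; lra.
Qed.

(** Two indices may denote one point; the estimates with d = 0 show that value and slope agree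
    there. *)
Lemma interpolation : exists (f : X -> Y) (V : X -> Y),
  [/\ forall i, valid i -> f (point i) = value i,
      forall i, valid i -> V (point i) = slope i &
      forall z z', point_set z -> point_set z' ->
        `|f z' - f z - tau (z' - z) *: V z| <= 10 * `|z' - z| ^+ 2 /\
        `|V z' - V z| <= 4 * `|z' - z|].
Proof.
have eq i j : valid i -> valid j -> point i = point j -> value i = value j /\ slope i = slope j.
  move=> vi vj ij; have [] := piece_estimates vi vj (erefl _).
  rewrite ij subrr linear0 scale0r subr0 normr0 expr0n !mulr0 !normr_le0 !subr_eq0.
  by move=> /eqP -> /eqP ->.
have [f fE] := factor_through 0 (fun i j vi vj ij => (eq i j vi vj ij).1).
have [V VE] := factor_through 0 (fun i j vi vj ij => (eq i j vi vj ij).2).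
exists f, V; split=> // _ _ [i vi <-] [j vj <-].
by have := piece_estimates vi vj (erefl _); rewrite !fE // !VE.
Qed.

End Assembly.

(* Piece 0 has scale 0: it is the origin, the limit of the other pieces. *)
Definition scale_seq (R : realType) (n : nat) : R := if n is n'.+1 then 4^-1 ^+ n'.+1 else 0.

Lemma scale_seq_le1 (R : realType) n : 0 <= scale_seq R n <= 1.
Proof.
case: n => [|n]; rewrite /scale_seq; first by rewrite lexx ler01.
by rewrite exprn_ge0 //= exprn_ile1 // invf_le1 // ler1n.
Qed.

Lemma scale_seq_gap (R : realType) m n : m <> n ->
  4 * scale_seq R m <= scale_seq R n \/ 4 * scale_seq R n <= scale_seq R m.
Proof.
have half p q : (p < q)%N -> 4 * 4^-1 ^+ q.+1 <= 4^-1 ^+ p.+1 :> R.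
  move=> pq; rewrite exprS mulVKf ?pnatr_eq0 //.
  by apply: ler_wiXn2l => //; rewrite invf_le1 // ler1n.
case: m n => [|m] [|n] mn /=; rewrite ?mulr0; [by left|by left; apply: exprn_ge0|
  by right; apply: exprn_ge0|].
have [lt|lt|E] := ltngtP m n; [right; exact: half|left; exact: half|].
by rewrite E in mn.
Qed.

Lemma scale_seq_small (R : realType) (r : R) : 0 < r ->
  exists m, forall n, (m <= n)%N -> 3 * scale_seq R n < r.
Proof.
move=> r0; have h : `|4^-1 : R| < 1 by rewrite ger0_norm // invf_lt1 // ltr1n.
have r3 : 0 < r / 3 by rewrite divr_gt0.
have [m _ mE] := (cvgr0_norm_lt _ (cvg_expr h)) _ r3.
exists m => n mn; rewrite mulrC -ltr_pdivlMr //.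
case: n mn => [|n] mn /=; first by [].
by apply: le_lt_trans (mE n.+1 mn); exact: ler_norm.
Qed.

Lemma empty_piece (R : realType) (X Y : normedModType R) (tau : {scalar X}) :
  admissible_piece tau 0 0 [set 0] set0 (fun=> 0 : Y).
Proof.
split=> //; first by rewrite lexx.
  by move=> _ ->; rewrite linear0 !normr0.
by move=> _ _ -> ->; rewrite subrr !normr0.
Qed.

Lemma linear_rank_one (R : realType) (X Y : normedModType R) (tau : {scalar X}) (w : Y) :
  exists L : {linear X -> Y}, forall v, L v = tau v *: w.
Proof.
have Llin : linear (fun v => tau v *: w).
  by move=> a u v; rewrite linearP /= scalerDl scalerA.
pose L0 := GRing.isLinear.Build R X Y *:%R (fun v => tau v *: w) Llin.
by exists (HB.pack (fun v => tau v *: w) L0 : {linear X -> Y}).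
Qed.

Theorem theorem24 (R : realType) (X Y : completeNormedModType R)
    (hX : infinite_dimensional X) (hY : infinite_dimensional Y)
    (hYe : sufficiently_euclidean Y)
    (omega : R -> \bar R) (homega : nontrivial_modulus omega) :
  exists (A : set X) (f : X -> Y),
    [/\ bounded_set A,
        closed A,
        [lipschitz f x | x in A],
        W11 A f &
        ~ exists (U : set X) (g : X -> Y),
            [/\ open U, U 0, C1_modulus omega U g &
                forall x, (A `&` U) x -> g x = f x]].
Proof.
have [e0 [tau [e0_norm tau_e0 tau_le systems]]] := biorthogonal_system hX.
have [C C0 factor] := euclidean_factorization hYe.
have cubes := cube_vectors systems.
have [omega_modulus _] := homega.
pose lam := scale_seq R.
have lam_ge0 n : 0 <= lam n by have /andP[] := scale_seq_le1 R n.
have lam_le1 n : lam n <= 1 by have /andP[] := scale_seq_le1 R n.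
(* Piece n excludes the constant K = n, for n > 0; piece 0 contributes the origin. *)
pose good n (p : R * set X * set X * (X -> Y)) :=
  [/\ admissible_piece tau (lam n) p.1.1.1 p.1.1.2 p.1.2 p.2, n = 0%N -> p.1.1.2 0 &
      (0 < n)%N -> nonextendable e0 omega (lam n) n%:R p.1.1.1 p.1.1.2 p.1.2 p.2].
have pick_piece n : exists p, good n p.
  case: n => [|n]; first by exists (0, [set 0], set0, fun=> 0); split=> //; exact: empty_piece.
  have lam0 : 0 < lam n.+1 by rewrite exprn_gt0 // invr_gt0.
  have n0 : 0 < n.+1%:R :> R by rewrite ltr0n.
  have [t [S [S' [Phi [h1 h2]]]]] := piece_exists e0_norm omega_modulus C0 lam0 n0 cubes factor.
  by exists (t, S, S', Phi).
have [P Pgood] := choice pick_piece.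
pose t n := (P n).1.1.1; pose S n := (P n).1.1.2; pose S' n := (P n).1.2; pose Phi n := (P n).2.
have pieces n : admissible_piece tau (lam n) (t n) (S n) (S' n) (Phi n) by have [] := Pgood n.
have gap := @scale_seq_gap R.
have [f [V [fE VE fV]]] := interpolation e0_norm tau_e0 tau_le lam_ge0 gap pieces.
pose A := point_set e0 lam t S S'.
have A3 z : A z -> `|z| <= 3 by exact: (point_set_bounded e0_norm lam_ge0 pieces lam_le1).
have V1 z : A z -> `|V z| <= 1.
  move=> [i vi <-]; rewrite VE //.
  exact: le_trans (norm_slope pieces vi) (lam_le1 _).
have [f1 f1E] := choice (fun z => linear_rank_one tau (V z)).
exists A, f; split.
- exists 3; split; first exact: num_real.
  by move=> M M3 z /A3 z3; apply: le_trans z3 (ltW M3).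
- apply: (point_set_closed e0_norm lam_ge0 pieces); first exact: scale_seq_small.
  have [_ /(_ erefl) S0 _] := Pgood 0%N.
  exists (0%N, 0, false); first by split.
  by rewrite /point /height /= mul0r !addr0 scale0r.
(* 10 |d|^2 <= 60 |d| because |d| <= 6, and the linear term adds at most |d|. *)
- exists 61; split; first exact: num_real.
  move=> M M61 [z z'] [/= Az Az'].
  have [+ _] := fV _ _ Az' Az; have := A3 _ Az; have := A3 _ Az'; have := V1 _ Az'.
  have := tau_le (z - z'); have := ler_normB z z'.
  set d := z - z' => dle td Vz z'3 z3 fd.
  have -> : f z - f z' = (f z - f z' - tau d *: V z') + tau d *: V z' by rewrite subrK.
  apply: le_trans (ler_normD _ _) _; rewrite normrZ.
  have d0 : 0 <= `|d| := normr_ge0 d.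
  have : `|tau d| * `|V z'| <= `|d| * 1 by apply: ler_pM.
  have : `|d| ^+ 2 <= 6 * `|d| by rewrite expr2 ler_wpM2r //; lra.
  have : 61 * `|d| <= M * `|d| by rewrite ler_wpM2r // ltW.
  lra.
- exists f1, 10; split=> //.
    move=> z _; apply: (@lipschitz_linear_continuous _ _ _ _ `|V z|) => v.
    by rewrite f1E normrZ mulrC ler_wpM2l.
  move=> z z' Az Az'; have [e1 e2] := fV _ _ Az Az'; split; first by rewrite f1E.
  apply: opnorm_le_of; first by rewrite mulr_ge0.
  move=> v; rewrite /= !f1E -scalerBr normrZ mulrC; apply: ler_pM => //.
  by apply: le_trans e2 _; rewrite ler_wpM2r // ler_nat.
move=> [U [g [oU U0 [gdiff _ [K K0 gK]] gf]]].
have [r r0 rU] : exists2 r : R, 0 < r & forall z, `|z| < r -> U z.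
  have /nbhs_ballP[r /= r0 rU] : nbhs 0 U by exact: open_nbhs_nbhs.
  by exists r => // z zr; apply: rU; rewrite -ball_normE /= sub0r normrN.
have [m mE] := scale_seq_small r0.
(* Large enough for piece n to lie in [U] and for n to dominate K. *)
pose n := maxn m (Num.truncn K).+1.
have Kn : K <= n%:R.
  apply: le_trans (ltW (truncnS_gt K)) _.
  by rewrite ler_nat leq_maxr.
have n0 : (0 < n)%N by apply: leq_trans (leq_maxr _ _).
have lamU z : `|z| <= 3 * lam n -> U z.
  by move=> zl; apply: rU; apply: le_lt_trans zl _; apply: mE; exact: leq_maxl.
have [_ _ /(_ n0)] := Pgood n; apply.
- by move=> z /lamU; exact: gdiff.
- move=> z z' /lamU Uz /lamU Uz'; apply: le_trans (gK _ _ Uz Uz') _.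
  by apply: lee_wpmul2r; [case: omega_modulus => h _ _ _; exact: h | rewrite lee_fin].
- move=> x Sx; have vi : valid S S' (n, x, false) by split.
  have E : lam n *: e0 + x = point e0 lam t (n, x, false).
    by rewrite /point /height /= mul0r addr0.
  rewrite E gf; first by rewrite fE // /value /= mul0r scale0r.
  split; first by exists (n, x, false).
  by apply: lamU; exact: (norm_point e0_norm lam_ge0 pieces vi).
- move=> x S'x; have Sx : S n x by have [_ _ _ sub _] := pieces n; exact: sub.
  have vi : valid S S' (n, x, true) by split.
  have E : lam n *: e0 + x + t n *: e0 = point e0 lam t (n, x, true).
    by rewrite /point /height /= mul1r scalerDl addrAC.
  rewrite -/(t n) E gf; first by rewrite fE // /value /= mul1r.
  split; first by exists (n, x, true).
  by apply: lamU; exact: (norm_point e0_norm lam_ge0 pieces vi).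
Qed.
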